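(* The calibration measure $\mathrm{ATB}$ is $O(1/\sqrt T)$-valid with respect to the reference calibration measure $\underline{\mathrm{distCal}}$; that is, there is a sequence $\gamma_1,\gamma_2,\ldots$ of real numbers with $\gamma_T=O(1/\sqrt T)$ such that $\mathrm{ATB}$ is $\{\gamma_T\}$-valid with respect to $\underline{\mathrm{distCal}}$. Moreover, this is optimal up to constant factors: if, for a sequence $\{\gamma_T\}$, there exists a calibration measure $\mathrm{CAL}$ that is $\{\gamma_T\}$-valid with respect to $\underline{\mathrm{distCal}}$, then $\gamma_T=\Omega(1/\sqrt T)$ (as $T\to\infty$).
   Context: A distribution $J$ of $(v,y)\in[0,1]\times\{0,1\}$ is calibrated if $\mathbb E_J[y\mid v]=v$ almost surely. A calibration measure is a function $\mathrm{CAL}$ assigning to each distribution $J$ on $[0,1]\times\{0,1\}$ a value $\mathrm{CAL}(J)\in\mathbb R_{\ge0}$ (with the events below measurable). $$\mathrm{ATB}(J)=\mathbb E_{q\sim\mathrm{Unif}([0,1])}\Big[\big(\mathbb E_J[(v-y)\mathbb I[v<q]]\big)^2+\big(\mathbb E_J[(v-y)\mathbb I[v\ge q]]\big)^2\Big].$$ $\underline{\mathrm{distCal}}(J)=\inf_\Pi\mathbb E_\Pi|u-v|$, where the infimum is over joint distributions $\Pi$ of $(u,v,y)\in[0,1]\times[0,1]\times\{0,1\}$ such that $(v,y)$ has distribution $J$ and the distribution of $(u,y)$ is calibrated. Acceptance probability: for $T\in\mathbb Z_{>0}$ and $\beta\in\mathbb R$, $\mathsf{accP}^{\mathrm{CAL}}(J;T,\beta):=\Pr_{S\sim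 J^T}[\mathrm{CAL}(J_S)\le\beta]$, where $S$ is a sample of $T$ i.i.d. points from $J$ and $J_S$ is the uniform distribution over $S$. Validity: for an infinite sequence $\{\gamma_T\}_{T=1,2,\ldots}$ of real numbers, $\mathrm{CAL}$ is $\{\gamma_T\}$-valid with respect to a reference calibration measure $\mathrm{Ref}$ if there exist thresholds $\beta_1,\beta_2,\ldots\in\mathbb R$ such that $$\liminf_{T\to\infty}\left(\inf_{J:\ J\text{ calibrated}}\mathsf{accP}^{\mathrm{CAL}}(J;T,\beta_T)-\sup_{J:\ \mathrm{Ref}(J)\ge\gamma_T}\mathsf{accP}^{\mathrm{CAL}}(J;T,\beta_T)\right)>0,$$ where the infimum and supremum are over distributions $J$ on $[0,1]\times\{0,1\}$ (a supremum of probabilities over the empty set is $0$). *)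

(* Defs.v *)
From HB Require Import structures.
From mathcomp Require Import all_boot all_order all_algebra.
From mathcomp Require Import all_classical all_reals all_analysis.

Set Implicit Arguments.
Unset Strict Implicit.
Unset Printing Implicit Defensive.

Import Order.TTheory GRing.Theory Num.Theory.
Import numFieldNormedType.Exports.

Local Open Scope classical_set_scope.
Local Open Scope ring_scope.

Section iid_sampling.
Context d (X : measurableType d) (R : realType).

Definition cons_tuple n (x : X * n.-tuple X) : n.+1.-tuple X :=
  [tuple of x.1 :: x.2].

Lemma measurable_cons_tuple n : measurable_fun setT (@cons_tuple n).
Proof. exact: measurable_cons. Qed.

HB.instance Definition _ n :=
  isMeasurableFun.Build _ _ _ _ (@cons_tuple n) (@measurable_cons_tuple n).

(* The product measure P^n on n-tuples: the law of n i.i.d. draws from P. *)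
Fixpoint iid (P : probability X R) (n : nat) : probability (n.-tuple X) R :=
  if n is m.+1 return probability (n.-tuple X) R
  then distribution (P \x iid P m)%E (@cons_tuple m)
  else \d_[tuple].

(* The uniform distribution over the sample [s], with multiplicities: the
   normalized sum of the Dirac masses of its points.  The point [x0] is only
   used for the empty sample, where the result is [\d_x0]. *)
Definition empirical (x0 : X) n (s : n.-tuple X) : probability X R :=
  mnormalize (msum (fun i => \d_(nth x0 s i)) n) \d_x0.

(* [g \o V] is a version of E[Y | V]. *)
Definition is_condexp (P : probability X R) (Y V : X -> R) (g : R -> R) :=
  [/\ measurable_fun setT g,
      P.-integrable setT (fun x => (g (V x))%:E) &
      forall A : set R, measurable A ->
        \int[P]_(x in V @^-1` A) Y x = \int[P]_(x in V @^-1` A) g (V x)].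

End iid_sampling.

Section calibration.
Variable R : realType.

(* A point is (v, y), with y : bool coerced to {0, 1}. *)
Definition unit_domain : set (R * bool) := `[0, 1] `*` [set: bool].

(* Distributions on [0, 1] x {0, 1} are the probability measures on R * bool
   that are concentrated on [unit_domain]. *)
Definition on_unit (J : probability (R * bool)%type R) : Prop :=
  J unit_domain = 1%E.

Definition label (x : R * bool) : R := x.2%:R.

(* E_J[y | v] = v almost surely. *)
Definition calibrated (J : probability (R * bool)%type R) : Prop :=
  exists2 g : R -> R, is_condexp J label fst g
                    & {ae J, forall x, g x.1 = x.1}.

(* Nonnegative function of distributions on [0, 1] x {0, 1}.  A [probability]
   also carries (irrelevant) values on nonmeasurable sets; the first clause
   says that a measure does not depend on them.  Values of [CAL] outside of
   [on_unit] are never used. *)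
Definition calibration_measure (CAL : probability (R * bool)%type R -> R) :=
  (forall J J', on_unit J -> on_unit J' ->
     (forall A, measurable A -> J A = J' A) -> CAL J = CAL J') /\
  (forall J, on_unit J -> 0 <= CAL J).

Definition ATB (J : probability (R * bool)%type R) : R :=
  \int[uniform_prob (@ltr01 R)]_q
    ((\int[J]_x ((x.1 - label x) * (x.1 < q)%R%:R)) ^+ 2 +
     (\int[J]_x ((x.1 - label x) * (q <= x.1)%R%:R)) ^+ 2).

(* Triples (u, (v, y)) *)
Definition proj_uy (x : R * (R * bool)) : R * bool := (x.1, x.2.2).

Lemma measurable_proj_uy : measurable_fun setT proj_uy.
Proof.
by apply: measurable_fun_pair => //; exact: measurableT_comp.
Qed.

HB.instance Definition _ :=
  isMeasurableFun.Build _ _ _ _ proj_uy measurable_proj_uy.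

Definition calibrated_coupling (J : probability (R * bool)%type R)
    (Pi : probability (R * (R * bool))%type R) : Prop :=
  [/\ forall A, measurable A -> Pi (snd @^-1` A) = J A,
      on_unit (distribution Pi proj_uy) &
      calibrated (distribution Pi proj_uy)].

Definition lower_distCal (J : probability (R * bool)%type R) : R :=
  inf [set \int[Pi]_x `|x.1 - x.2.1| | Pi in calibrated_coupling J].

Definition empirical_dist T (S : T.-tuple (R * bool)%type) :
  probability (R * bool)%type R := empirical R ((0 : R), false) S.

(* {CAL(J_S) <= beta}, as an event of the sample space
   ([0, 1] x {0, 1})^T. *)
Definition accept_event (CAL : probability (R * bool)%type R -> R)
    (T : nat) (beta : R) : set (T.-tuple (R * bool)%type) :=
  [set S | (forall i, unit_domain (tnth S i)) /\
           CAL (empirical_dist S) <= beta].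

Definition measurable_acceptance
    (CAL : probability (R * bool)%type R -> R) : Prop :=
  forall (T : nat) (beta : R), (0 < T)%N -> 
    measurable (@accept_event CAL T beta).

Definition accP (CAL : probability (R * bool)%type R -> R)
    (J : probability (R * bool)%type R) (T : nat) (beta : R) : R :=
  fine (iid J T (@accept_event CAL T beta)).

(* Sequences over T = 1, 2, ... are functions on nat whose value at 0 is
   irrelevant.  For reals, [sup set0 = 0]. *)
Definition valid (CAL Ref : probability (R * bool)%type R -> R)
    (gamma : nat -> R) : Prop :=
  exists beta : nat -> R,
    (0 < limn_einf (fun T : nat =>
       (inf [set accP CAL J T (beta T)
            | J in [set J | on_unit J /\ calibrated J]] -
        sup [set accP CAL J T (beta T)
            | J in [set J | on_unit J /\ (gamma T <= Ref J)%R]])%:E))%E.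

Definition inv_sqrt (T : nat) : R := (Num.sqrt T%:R)^-1.

End calibration.

Arguments ATB {R}.
Arguments lower_distCal {R}.

(* Main.v *)
(* Upper bound.  Let A_q and B_q be the expectations of (v - y) over v < q and
   over v >= q, so that ATB is the mean over q of A_q^2 + B_q^2.  The empirical
   A_q and B_q deviate from their means by O(1/T) in mean square, uniformly in
   J; by Markov's inequality the threshold 8/T accepts calibrated J, for which
   A_q = B_q = 0, with probability at least 3/4, and accepts J with
   ATB(J) > 32/T with probability at most 1/4.  It remains to see that
   lower_distCal(J)^2 <= 72 ATB(J).  Move v to h(v) with h affine such that
   E h(v) = E y, at cost |E(v - y)|, and let K be the calibrated law of
   (h(v), Bernoulli(h(v))).  J and K have the same label mean, so they can be
   coupled monotonically label by label; as in the formula for W_1 on the line,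
   the cost is the integral of the differences of the distribution functions,
   which are A_q up to O(|E(v - y)|).

   Lower bound.  Take v = 1/2 and y Bernoulli(1/2) (calibrated) or
   Bernoulli(1/2 + e).  The latter has lower_distCal >= e because a calibrated
   u has E u = E y, but the chi-square divergence of the T-samples is
   (1 + 4 e^2)^T - 1, which is small unless e is of order 1/sqrt T. *)

Require Import Defs.
From HB Require Import structures.
From mathcomp Require Import all_boot all_order all_algebra.
From mathcomp Require Import all_classical all_reals all_analysis.
From mathcomp Require Import measurable_realfun ring lra.

Set Implicit Arguments.
Unset Strict Implicit.
Unset Printing Implicit Defensive.

Import Order.TTheory GRing.Theory Num.Theory.
Import numFieldNormedType.Exports.

Local Open Scope classical_set_scope.
Local Open Scope ring_scope.

(** * Bounded measurable functions *)

Section bounded_measurable.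
Context d (T : measurableType d) (R : realType).
Implicit Types (f g : T -> R) (P : probability T R).

(** Bounded everywhere rather than almost everywhere, so that such functions are integrable for
    every probability and stable under sections and partial integration. *)
Definition bmeas f := measurable_fun setT f /\ exists M, forall x, `|f x| <= M.

Lemma bmeas_cst (c : R) : bmeas (fun=> c).
Proof. by split; [exact: measurable_cst|exists `|c|]. Qed.

Lemma bmeasD f g : bmeas f -> bmeas g -> bmeas (fun x => f x + g x).
Proof.
move=> [mf [M fM]] [mg [N gN]]; split; first exact: measurable_funD.
by exists (M + N) => x; rewrite (le_trans (ler_normD _ _))// lerD.
Qed.

Lemma bmeasM f g : bmeas f -> bmeas g -> bmeas (fun x => f x * g x).
Proof.
move=> [mf [M fM]] [mg [N gN]]; split; first exact: measurable_funM.
by exists (M * N) => x; rewrite normrM ler_pM.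
Qed.

Lemma bmeasN f : bmeas f -> bmeas (fun x => - f x).
Proof.
move=> [mf [M fM]]; split; first exact: measurable_funN.
by exists M => x; rewrite normrN.
Qed.

Lemma bmeasB f g : bmeas f -> bmeas g -> bmeas (fun x => f x - g x).
Proof. by move=> bf bg; apply: bmeasD => //; exact: bmeasN. Qed.

Lemma bmeas_norm f : bmeas f -> bmeas (fun x => `|f x|).
Proof.
move=> [mf [M fM]]; split; first exact: measurableT_comp.
by exists M => x; rewrite normr_id.
Qed.

Lemma bmeasX2 f : bmeas f -> bmeas (fun x => f x ^+ 2).
Proof. by move=> bf; under eq_fun do rewrite expr2; exact: bmeasM. Qed.

Lemma bmeas_sum (I : Type) (s : seq I) (F : I -> T -> R) :
  (forall i, bmeas (F i)) -> bmeas (fun x => \sum_(i <- s) F i x).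
Proof.
move=> bF; elim: s => [|i s IH].
  by under eq_fun do rewrite big_nil; exact: bmeas_cst.
by under eq_fun do rewrite big_cons; exact: bmeasD.
Qed.

Lemma bmeas_bool (b : T -> bool) : measurable_fun setT b ->
  bmeas (fun x => (b x)%:R).
Proof.
move=> mb; split; last by exists 1 => x; case: (b x); rewrite ?normr1 ?normr0.
rewrite [X in measurable_fun _ X](_ : _ = fun x => if b x then 1 else 0).
  exact: measurable_fun_ifT.
by apply/funext => x; case: (b x).
Qed.

Lemma bmeas_indic (A : set T) : measurable A -> bmeas (\1_A).
Proof.
move=> mA; split; first exact: measurable_indic.
by exists 1 => x; rewrite indicE; case: (_ \in _); rewrite ?normr1 ?normr0.
Qed.

Lemma bmeas_integrable P f : bmeas f -> P.-integrable setT (EFin \o f).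
Proof.
move=> [mf [M fM]]; apply: (@le_integrable _ _ _ P _ measurableT _ (cst M%:E)).
- exact/measurable_EFinP.
- by move=> x _ /=; rewrite lee_fin (le_trans (fM x))// ler_norm.
- by apply: finite_measure_integrable_cst.
Qed.

Lemma RintD P f g : bmeas f -> bmeas g ->
  \int[P]_x (f x + g x) = \int[P]_x f x + \int[P]_x g x.
Proof. by move=> bf bg; rewrite RintegralD//; exact: bmeas_integrable. Qed.

Lemma RintB P f g : bmeas f -> bmeas g ->
  \int[P]_x (f x - g x) = \int[P]_x f x - \int[P]_x g x.
Proof. by move=> bf bg; rewrite RintegralB//; exact: bmeas_integrable. Qed.

Lemma RintZ P f c : bmeas f -> \int[P]_x (c * f x) = c * \int[P]_x f x.
Proof. by move=> bf; rewrite RintegralZl//; exact: bmeas_integrable. Qed.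

Lemma Rint_cst P c : \int[P]_x c = c.
Proof.
have P1 : fine (P setT) = 1 by rewrite probability_setT.
by rewrite Rintegral_cst// [X in c * X]P1 mulr1.
Qed.

Lemma le_Rint P f g : bmeas f -> bmeas g -> (forall x, f x <= g x) ->
  \int[P]_x f x <= \int[P]_x g x.
Proof. by move=> bf bg fg; apply: le_Rintegral => //; exact: bmeas_integrable. Qed.

Lemma ler_norm_Rint P f : bmeas f -> `|\int[P]_x f x| <= \int[P]_x `|f x|.
Proof. by move=> bf; apply: le_normr_Rintegral => //; exact: bmeas_integrable. Qed.

Lemma Rint_indic P A : measurable A -> \int[P]_x \1_A x = fine (P A).
Proof. by move=> mA; rewrite /Rintegral integral_indic// setIT. Qed.

Lemma Rint_ae_eq P f g (D : set T) : measurable D -> P D = 1%E ->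
  measurable_fun setT f -> measurable_fun setT g ->
  (forall x, D x -> f x = g x) -> \int[P]_x f x = \int[P]_x g x.
Proof.
move=> mD D1 mf mg fg; rewrite /Rintegral; congr fine.
apply: ae_eq_integral => //; [exact/measurable_EFinP|exact/measurable_EFinP|].
have PDC : P (~` D) = 0%E by rewrite probability_setC// D1 subee.
exists (~` D); split => //; first exact: measurableC.
by move=> x /= nfg Dx; apply: nfg => _; rewrite fg.
Qed.

Lemma le_Rint_on P f g (D : set T) : measurable D -> P D = 1%E ->
  bmeas f -> bmeas g -> (forall x, D x -> f x <= g x) ->
  \int[P]_x f x <= \int[P]_x g x.
Proof.
move=> mD D1 bf bg fg; have bD := bmeas_indic mD.
have restr h : bmeas h -> \int[P]_x h x = \int[P]_x (h x * \1_D x).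
  move=> bh; apply: (Rint_ae_eq mD D1); [exact: bh.1|exact: (bmeasM bh bD).1|].
  by move=> x Dx; rewrite indicE mem_set// mulr1.
rewrite (restr f)// (restr g)//; apply: le_Rint; [exact: bmeasM|exact: bmeasM|].
move=> x; rewrite indicE; case: (boolP (x \in D)); rewrite ?mulr0 ?mulr1//.
by move=> /set_mem; exact: fg.
Qed.

Lemma eq_probability_on P (A B D : set T) : measurable A -> measurable B ->
  measurable D -> P D = 1%E -> (forall x, D x -> A x <-> B x) -> P A = P B.
Proof.
move=> mA mB mD D1 AB.
suff : fine (P A) = fine (P B).
  by move=> AB'; rewrite -[LHS]fineK ?fin_num_measure// AB' fineK// fin_num_measure.
rewrite -!Rint_indic//; apply: (Rint_ae_eq mD D1) => // x Dx.
have [ABx BAx] := AB x Dx; rewrite !indicE; congr (nat_of_bool _)%:R.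
by apply/idP/idP => /set_mem h; apply/mem_set; [exact: ABx|exact: BAx].
Qed.

(** The variance [E (f - m)^2 = E f^2 - m^2] is nonnegative. *)
Lemma sqr_Rint_le P f : bmeas f -> (\int[P]_x f x) ^+ 2 <= \int[P]_x (f x ^+ 2).
Proof.
move=> bf; set m := \int[P]_x f x.
have : 0 <= \int[P]_x ((f x - m) ^+ 2).
  by apply: Rintegral_ge0 => x _; exact: sqr_ge0.
under eq_Rintegral.
  move=> x _; rewrite (_ : (f x - m) ^+ 2 = f x ^+ 2 - (2 * m * f x - m ^+ 2));
    last by ring.
  over.
have bm := bmeas_cst.
rewrite RintB; [|exact: bmeasX2|by apply: bmeasB => //; exact: bmeasM].
rewrite RintB; [|exact: bmeasM|exact: bm].
rewrite RintZ// Rint_cst -/m; nra.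
Qed.

Lemma markov_Rint P f (a : R) : bmeas f -> (forall x, 0 <= f x) -> 0 < a ->
  fine (P [set x | a < f x]) <= \int[P]_x f x / a.
Proof.
move=> bf f0 a0.
have mA : measurable [set x | a < f x].
  rewrite [X in measurable X](_ : _ = f @^-1` `]a, +oo[).
    by rewrite -[X in measurable X]setTI; apply: bf.1.
  by apply/seteqP; split => x /=; rewrite in_itv/= andbT.
rewrite ler_pdivlMr// mulrC -Rint_indic// -RintZ; last exact: bmeas_indic.
apply: le_Rint => //; first by apply: bmeasM; [exact: bmeas_cst|exact: bmeas_indic].
move=> x; rewrite indicE; case: (boolP (x \in _)); rewrite ?mulr0 ?mulr1//.
by rewrite inE/= => /ltW.
Qed.

End bounded_measurable.

Lemma bmeas_comp d d' (T : measurableType d) (T' : measurableType d')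
    (R : realType) (h : T' -> T) (f : T -> R) :
  measurable_fun setT h -> bmeas f -> bmeas (fun x => f (h x)).
Proof.
move=> mh [mf [M fM]]; split; first exact: (measurableT_comp mf mh).
by exists M.
Qed.

(** * Fubini for bounded measurable functions *)

Section bounded_product.
Context d1 d2 (T1 : measurableType d1) (T2 : measurableType d2) (R : realType).
Variables (P : probability T1 R) (Q : probability T2 R).
Variables (f : T1 * T2 -> R) (bf : bmeas f).

Let intf : (P \x Q)%E.-integrable setT (EFin \o f).
Proof. exact: bmeas_integrable. Qed.

Lemma bmeas_pair1 x : bmeas (fun y => f (x, y)).
Proof. by apply: (bmeas_comp (h := fun y => (x, y))) => //; exact: pair1_measurable. Qed.

Lemma bmeas_pair2 y : bmeas (fun x => f (x, y)).
Proof. by apply: (bmeas_comp (h := fun x => (x, y))) => //; exact: pair2_measurable. Qed.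

Lemma Rint_EFin d (T : measurableType d) (P' : probability T R) (g : T -> R) :
  bmeas g -> (\int[P']_x (g x)%:E = (\int[P']_x g x)%:E)%E.
Proof.
move=> bg; rewrite /Rintegral fineK//; apply: integrable_fin_num => //.
exact: bmeas_integrable.
Qed.

(** Tonelli gives measurability for nonnegative integrands, so [f] is first shifted by its bound
    [M]. *)
Lemma bmeas_Rint1 : bmeas (fun x => \int[Q]_y f (x, y)).
Proof.
have [mf [M fM]] := bf; have bM d (T : measurableType d) := bmeas_cst T M.
split; last first.
  exists M => x; rewrite (le_trans (ler_norm_Rint _ (bmeas_pair1 x)))//.
  rewrite -[leRHS](Rint_cst Q); apply: le_Rint => //.
  exact/bmeas_norm/bmeas_pair1.
have fM0 z : 0 <= f z + M.
  by have := fM z; rewrite ler_norml => /andP[+ _]; rewrite -lerBlDr sub0r.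
rewrite [X in measurable_fun _ X](_ : _ =
    fun x => \int[Q]_y (f (x, y) + M) - M); last first.
  by apply/funext => x; rewrite RintD ?Rint_cst ?addrK//; exact: bmeas_pair1.
apply: measurable_funB => //; apply/measurable_EFinP.
rewrite [X in measurable_fun _ X](_ : _ =
    fubini_F Q (fun z => (f z + M)%:E)).
  apply: measurable_fun_fubini_tonelli_F => [|z]; last by rewrite lee_fin.
  by apply/measurable_EFinP; exact: (bmeasD bf (bM _ _)).1.
apply/funext => x /=; rewrite /fubini_F /= Rint_EFin//.
by apply: bmeasD => //; exact: bmeas_pair1.
Qed.

Lemma Rint_prod1 : \int[(P \x Q)%E]_z f z = \int[P]_x \int[Q]_y f (x, y).
Proof.
rewrite /Rintegral; congr fine; rewrite -(integral12_prod_meas1 intf).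
by apply: eq_integral => x _; rewrite /fubini_F/= Rint_EFin//; exact: bmeas_pair1.
Qed.

Lemma Rint_prod2 : \int[(P \x Q)%E]_z f z = \int[Q]_y \int[P]_x f (x, y).
Proof.
rewrite /Rintegral; congr fine; rewrite -(integral21_prod_meas1 intf).
by apply: eq_integral => x _; rewrite /fubini_G/= Rint_EFin//; exact: bmeas_pair2.
Qed.

Lemma Rint_exchange :
  \int[P]_x \int[Q]_y f (x, y) = \int[Q]_y \int[P]_x f (x, y).
Proof. by rewrite -Rint_prod1 Rint_prod2. Qed.

End bounded_product.

Lemma bmeas_Rint2 d1 d2 (T1 : measurableType d1) (T2 : measurableType d2)
    (R : realType) (P : probability T1 R) (f : T1 * T2 -> R) :
  bmeas f -> bmeas (fun y => \int[P]_x f (x, y)).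
Proof.
move=> bf; apply: (bmeas_Rint1 P (f := fun z => f (z.2, z.1))).
by apply: (bmeas_comp (h := fun z => (z.2, z.1))) => //; exact: measurable_fun_pair.
Qed.

Lemma Rint_distribution d d' (T : measurableType d) (T' : measurableType d')
    (R : realType) (P : probability T R) (X : {mfun T >-> T'}) (f : T' -> R) :
  measurable_fun setT f -> bmeas (fun x => f (X x)) ->
  \int[distribution P X]_y f y = \int[P]_x f (X x).
Proof.
move=> mf bf; rewrite /Rintegral; congr fine.
rewrite (@integral_distribution _ _ _ _ _ P X (EFin \o f))//.
  exact/measurable_EFinP.
exact: (@bmeas_integrable _ _ _ P (fun x => f (X x))).
Qed.

Lemma eq_measure_Rint d (T : measurableType d) (R : realType)
    (P Q : probability T R) (D : set T) (f : T -> R) : measurable D ->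
  (forall A, measurable A -> P A = Q A) ->
  \int[P]_(x in D) f x = \int[Q]_(x in D) f x.
Proof.
move=> mD PQ; rewrite /Rintegral; congr fine.
by apply: eq_measure_integral => // A mA _; exact: PQ.
Qed.

(** * Sums of i.i.d. variables and empirical distributions *)

Section iid_sums.
Context d (X : measurableType d) (R : realType).
Variable P : probability X R.

Lemma Rint_iidS n (f : n.+1.-tuple X -> R) : bmeas f ->
  \int[iid P n.+1]_s f s = \int[P]_x \int[iid P n]_s f (Defs.cons_tuple (x, s)).
Proof.
move=> bf; have bc : bmeas (fun z : X * n.-tuple X => f (Defs.cons_tuple z)).
  by apply: bmeas_comp bf; exact: Defs.measurable_cons_tuple.
rewrite /= Rint_distribution//; last exact: bf.1.
by rewrite (@Rint_prod1 _ _ _ _ _ _ _ (fun z => f (Defs.cons_tuple z))).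
Qed.

Lemma bmeas_tnth n (f : X -> R) (i : 'I_n) : bmeas f ->
  bmeas (fun s : n.-tuple X => f (tnth s i)).
Proof. by move=> bf; apply: bmeas_comp => //; exact: measurable_tnth. Qed.

Lemma bmeas_sum_tnth n (f : X -> R) : bmeas f ->
  bmeas (fun s : n.-tuple X => \sum_(i < n) f (tnth s i)).
Proof. by move=> bf; apply: bmeas_sum => i; exact: bmeas_tnth. Qed.

Lemma sum_cons_tuple n (f : X -> R) x (s : n.-tuple X) :
  \sum_(i < n.+1) f (tnth (Defs.cons_tuple (x, s)) i) =
  f x + \sum_(i < n) f (tnth s i).
Proof.
rewrite big_ord_recl tnth0; congr (_ + _).
by apply: eq_bigr => i _; rewrite tnthS.
Qed.

Variables (f : X -> R) (bf : bmeas f) (f0 : \int[P]_x f x = 0).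

Lemma iid_sum_mean n : \int[iid P n]_s \sum_(i < n) f (tnth s i) = 0.
Proof.
elim: n => [|n IH].
  by under eq_Rintegral do rewrite big_ord0; rewrite Rint_cst.
rewrite Rint_iidS; last exact: bmeas_sum_tnth.
under eq_Rintegral => x _.
  under eq_Rintegral do rewrite sum_cons_tuple.
  rewrite RintD ?Rint_cst ?IH; [|exact: bmeas_cst|exact: bmeas_sum_tnth].
  rewrite addr0; over.
exact: f0.
Qed.

(** When a draw is added, the cross term of the expanded square vanishes, because the remaining sum
    is independent of that draw and has mean 0. *)
Lemma iid_sum_var n :
  \int[iid P n]_s (\sum_(i < n) f (tnth s i)) ^+ 2 =
  n%:R * \int[P]_x (f x ^+ 2).
Proof.
elim: n => [|n IH].
  by under eq_Rintegral do rewrite big_ord0 expr0n/=; rewrite Rint_cst mul0r.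
have bs := @bmeas_sum_tnth n _ bf.
rewrite Rint_iidS; last exact/bmeasX2/bmeas_sum_tnth.
under eq_Rintegral => x _.
  under eq_Rintegral do rewrite sum_cons_tuple sqrrD -addrA -mulrnAl.
  have bc c : bmeas (fun _ : n.-tuple X => c : R) by exact: bmeas_cst.
  rewrite RintD//; last by apply: bmeasD; [exact: bmeasM|exact: bmeasX2].
  rewrite RintD//; [|exact: bmeasM|exact: bmeasX2].
  rewrite Rint_cst RintZ// iid_sum_mean mulr0 add0r IH; over.
rewrite RintD; [|exact: bmeasX2|exact: bmeas_cst].
by rewrite Rint_cst -natr1 mulrDl mul1r addrC.
Qed.

End iid_sums.

Section iid_support.
Context d (X : measurableType d) (R : realType).
Variables (P : probability X R) (D : set X).
Hypotheses (mD : measurable D) (PD : P D = 1%E).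

Lemma measurable_forall_tnth n :
  measurable [set s : n.-tuple X | forall i, D (tnth s i)].
Proof.
rewrite (_ : [set s | _] = \bigcap_(i in [set: 'I_n]) ((@tnth n X)^~ i @^-1` D)).
  apply: fin_bigcap_measurable => // i _.
  by rewrite -[X in measurable X]setTI; exact: measurable_tnth.
by apply/seteqP; split => s /= h i; [move=> _|]; exact: h.
Qed.

Lemma iid_support n : iid P n [set s | forall i, D (tnth s i)] = 1%E.
Proof.
set E := [set s | _].
have mE : measurable E := @measurable_forall_tnth n.
have bDC : bmeas (\1_(~` D) : X -> R).
  by apply: bmeas_indic; exact: measurableC.
have PDC : \int[P]_x (\1_(~` D) x : R) = 0.
  rewrite Rint_indic; last exact: measurableC.
  by rewrite probability_setC// PD subee.
have := iid_sum_mean bDC PDC n => h.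
have EC0 : fine (iid P n (~` E)) <= 0.
  rewrite -h -Rint_indic; last exact: measurableC.
  apply: le_Rint; [by apply: bmeas_indic; exact: measurableC
                  |exact: bmeas_sum_tnth|].
  move=> s; rewrite indicE; case: (boolP (s \in _)); last first.
    by move=> _; apply: sumr_ge0 => i _; rewrite indicE.
  rewrite inE/= => /existsNP[i nDi].
  rewrite (bigD1 i)//= indicE mem_set//= lerDl.
  by apply: sumr_ge0 => j _; rewrite indicE.
have : iid P n (~` E) = 0%E.
  apply/eqP; rewrite -fine_eq0 ?fin_num_measure//; last exact: measurableC.
  by rewrite eq_le EC0 fine_ge0.
rewrite probability_setC// => /eqP; rewrite sube_eq//.
  by rewrite add0e => /eqP.
Qed.

End iid_support.

(** * Integration against the empirical distribution *)

Section empirical.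
Context d (X : measurableType d) (R : realType).
Variables (x0 : X) (n : nat) (s : n.-tuple X).
Hypothesis n0 : (0 < n)%N.

Lemma empiricalE A : measurable A ->
  empirical R x0 s A = ((n%:R^-1)%:E * \sum_(i < n) \d_(tnth s i) A)%E.
Proof.
move=> mA.
have sE B : msum (fun i => \d_(nth x0 s i) : {measure set X -> \bar R}) n B =
    (\sum_(i < n) \d_(tnth s i) B)%E.
  by rewrite /msum; apply: eq_bigr => i _; rewrite (tnth_nth x0).
have sT : msum (fun i => \d_(nth x0 s i) : {measure set X -> \bar R}) n setT =
    (n%:R)%:E.
  rewrite sE; under eq_bigr do rewrite diracT.
  by rewrite sumEFin sumr_const card_ord.
(* The total mass [n] is neither 0 nor infinite, so the normalization does not fall back on the
   Dirac mass at [x0]. *)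
rewrite /empirical /= /mnormalize; rewrite [X in X == 0%E]sT [X in X == +oo%E]sT.
case: ifPn => [|_].
  by rewrite orbF eqe pnatr_eq0 eqn0Ngt n0.
by rewrite [X in (X * _)%E]sE [X in fine X]sT muleC.
Qed.

Lemma Rint_empirical (f : X -> R) : bmeas f ->
  \int[empirical R x0 s]_x f x = n%:R^-1 * \sum_(i < n) f (tnth s i).
Proof.
move=> bf; have [mf [M fM]] := bf.
have nn0 : n%:R != 0 :> R by rewrite pnatr_eq0 -lt0n.
have bM : bmeas (fun _ : X => M) by exact: bmeas_cst.
(* Shifting by the bound [M] makes the integrand nonnegative, as required to integrate against a
   scaled sum of measures. *)
suff : \int[empirical R x0 s]_x (f x + M) =
       n%:R^-1 * \sum_(i < n) (f (tnth s i) + M).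
  rewrite RintD// Rint_cst big_split/= mulrDr sumr_const card_ord.
  by rewrite -[M *+ n]mulr_natl mulKf// => /addIr.
have fM0 x : 0 <= f x + M.
  by have := fM x; rewrite ler_norml => /andP[+ _]; rewrite -lerBlDr sub0r.
have nn : 0 <= n%:R^-1 :> R by rewrite invr_ge0.
rewrite /Rintegral.
rewrite (eq_measure_integral (mscale (NngNum nn)
   (msum (fun i => \d_(nth x0 s i) : {measure set X -> \bar R}) n))); last first.
  move=> A mA _; rewrite [LHS]empiricalE// /mscale/= /msum; congr (_ * _)%E.
  by apply: eq_bigr => i _; rewrite (tnth_nth x0).
have mfM : measurable_fun setT (fun x => (f x + M)%:E).
  by apply/measurable_EFinP; exact: (bmeasD bf bM).1.
rewrite ge0_integral_mscale//; last by move=> x _; rewrite lee_fin.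
rewrite ge0_integral_measure_sum//; last by move=> x _; rewrite lee_fin.
under eq_bigr do rewrite integral_dirac// diracT mul1e -(tnth_nth x0 s).
by rewrite sumEFin.
Qed.

Lemma empirical_support (D : set X) : measurable D ->
  (forall i, D (tnth s i)) -> empirical R x0 s D = 1%E.
Proof.
move=> mD Ds; rewrite empiricalE//.
under eq_bigr do rewrite diracE mem_set//.
rewrite sumEFin sumr_const card_ord -EFinM mulVf//.
by rewrite pnatr_eq0 -lt0n.
Qed.

End empirical.

(** * Concentration of ATB *)

Section mean_square_deviation.
Context d d' (X : measurableType d) (Y : measurableType d') (R : realType).
Variables (P : probability X R) (U : probability Y R) (f : X * Y -> R).
Hypotheses (bf : bmeas f) (f1 : forall z, `|f z| <= 1).

Definition sample_mean n (s : n.-tuple X) (q : Y) : R :=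
  n%:R^-1 * \sum_(i < n) f (tnth s i, q).

Definition deviation n (s : n.-tuple X) : R :=
  \int[U]_q (sample_mean s q - \int[P]_x f (x, q)) ^+ 2.

Lemma bmeas_sample_mean n :
  bmeas (fun z : n.-tuple X * Y => sample_mean z.1 z.2).
Proof.
apply: bmeasM; first exact: bmeas_cst.
apply: bmeas_sum => i; apply: (bmeas_comp (h := fun z => (tnth z.1 i, z.2))) => //.
apply: measurable_fun_pair => //.
exact: (measurableT_comp (measurable_tnth i)).
Qed.

Lemma bmeas_deviation_integrand n : bmeas (fun z : n.-tuple X * Y =>
  (sample_mean z.1 z.2 - \int[P]_x f (x, z.2)) ^+ 2).
Proof.
apply/bmeasX2/bmeasB; first exact: bmeas_sample_mean.
by apply: (bmeas_comp (f := fun q => \int[P]_x f (x, q))) => //; exact: bmeas_Rint2.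
Qed.

Lemma bmeas_deviation n : bmeas (@deviation n).
Proof. exact: (bmeas_Rint1 U (@bmeas_deviation_integrand n)). Qed.

Lemma variance_le1 (g : X -> R) : bmeas g -> (forall x, `|g x| <= 1) ->
  \int[P]_x (g x - \int[P]_x g x) ^+ 2 <= 1.
Proof.
move=> bg g1; set m := \int[P]_x g x.
have -> : \int[P]_x (g x - m) ^+ 2 =
          \int[P]_x (g x ^+ 2 - (2 * m * g x - m ^+ 2)).
  by apply: eq_Rintegral => x _; ring.
have bc := bmeas_cst X.
rewrite RintB; [|exact: bmeasX2|by apply: bmeasB => //; exact: bmeasM].
rewrite RintB; [|exact: bmeasM|exact: bc].
rewrite Rint_cst RintZ// -/m.
have : \int[P]_x (g x ^+ 2) <= 1.
  rewrite -[leRHS](Rint_cst P); apply: le_Rint; [exact: bmeasX2|exact: bc|].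
  by move=> x; rewrite -[_ ^+ 2]real_normK ?num_real// expr_le1.
nra.
Qed.

(** Exchange the mean over samples with the mean over [q]: for each fixed [q] the mean square error
    is a variance divided by [n], and the variance is at most 1. *)
Lemma deviation_mean n : (0 < n)%N ->
  \int[iid P n]_s deviation s <= n%:R^-1.
Proof.
move=> n0; have nn0 : n%:R != 0 :> R by rewrite pnatr_eq0 -lt0n.
rewrite (Rint_exchange _ _ (@bmeas_deviation_integrand n)) /=.
rewrite -[leRHS](Rint_cst U); apply: le_Rint.
- exact: (bmeas_Rint2 (iid P n) (@bmeas_deviation_integrand n)).
- exact: bmeas_cst.
move=> q; set m := \int[P]_x f (x, q).
have bq : bmeas (fun x => f (x, q)) by exact: bmeas_pair2.
have bg : bmeas (fun x => f (x, q) - m) by apply: bmeasB => //; exact: bmeas_cst.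
have g0 : \int[P]_x (f (x, q) - m) = 0.
  by rewrite RintB//; [rewrite Rint_cst subrr|exact: bmeas_cst].
have -> : \int[iid P n]_s (sample_mean s q - m) ^+ 2 =
    \int[iid P n]_s (n%:R^-1 ^+ 2 * (\sum_(i < n) (f (tnth s i, q) - m)) ^+ 2).
  apply: eq_Rintegral => s _; rewrite -exprMn; congr (_ ^+ 2).
  rewrite big_split/= sumr_const card_ord mulrDr -[- m *+ n]mulr_natl.
  by rewrite mulKf.
rewrite RintZ; last exact: bmeasX2 (bmeas_sum_tnth _ bg).
rewrite (iid_sum_var bg g0) mulrA.
have -> : n%:R^-1 ^+ 2 * n%:R = n%:R^-1 :> R by rewrite expr2 -mulrA mulVf ?mulr1.
by rewrite ler_piMr ?invr_ge0// variance_le1.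
Qed.

End mean_square_deviation.

Section two_deviations.
Context d d' (X : measurableType d) (Y : measurableType d') (R : realType).
Variables (P : probability X R) (U : probability Y R) (f g : X * Y -> R).
Hypotheses (bf : bmeas f) (bg : bmeas g).
Hypotheses (f1 : forall z, `|f z| <= 1) (g1 : forall z, `|g z| <= 1).

(** The abstract form of ATB, with [f] and [g] in the role of the two bins. *)
Definition energy := \int[U]_q ((\int[P]_x f (x, q)) ^+ 2 +
                                (\int[P]_x g (x, q)) ^+ 2).

Definition sample_energy n (s : n.-tuple X) :=
  \int[U]_q (sample_mean f s q ^+ 2 + sample_mean g s q ^+ 2).

Let dev n (s : n.-tuple X) := deviation P U f s + deviation P U g s.

Lemma bmeas_sample_energy n : bmeas (@sample_energy n).
Proof.
apply: (bmeas_Rint1 U (f := fun z : n.-tuple X * Y =>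
   sample_mean f z.1 z.2 ^+ 2 + sample_mean g z.1 z.2 ^+ 2)).
by apply: bmeasD; apply: bmeasX2; exact: bmeas_sample_mean.
Qed.

Lemma deviation_tail n : (0 < n)%N ->
  fine (iid P n [set s | 8 / n%:R < dev s]) <= 4^-1.
Proof.
move=> n0; have nn0 : 0 < n%:R :> R by rewrite ltr0n.
have bdf := @bmeas_deviation _ _ _ _ _ P U _ bf n.
have bdg := @bmeas_deviation _ _ _ _ _ P U _ bg n.
have d0 (h : X * Y -> R) (s : n.-tuple X) : 0 <= deviation P U h s.
  by apply: Rintegral_ge0 => q _; exact: sqr_ge0.
have d0' s : 0 <= @dev n s by rewrite addr_ge0.
have a0 : 0 < 8 / n%:R :> R by rewrite divr_gt0.
(* Each deviation has mean at most [1 / n]; [8 / n] is four times the resulting bound [2 / n],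
   whence [4^-1]. *)
apply: (le_trans (markov_Rint (iid P n) (bmeasD bdf bdg) d0' a0)).
rewrite ler_pdivrMr// (RintD _ bdf bdg).
apply: (le_trans (lerD (deviation_mean P U bf f1 n0) (deviation_mean P U bg g1 n0))).
move: (n%:R^-1 : R) => m; lra.
Qed.

Let bsm (h : X * Y -> R) n (s : n.-tuple X) : bmeas h ->
  bmeas (fun q => sample_mean h s q).
Proof. by move=> bh; exact: (bmeas_pair1 (bmeas_sample_mean bh n) s). Qed.

Lemma energy_le_sample n (s : n.-tuple X) :
  energy <= 2 * sample_energy s + 2 * dev s.
Proof.
have bf1 := bsm s bf; have bg1 := bsm s bg.
have bf2 := bmeas_Rint2 P bf; have bg2 := bmeas_Rint2 P bg.
have bX2 (h : Y -> R) := @bmeasX2 _ _ _ h.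
have bD (h k : Y -> R) := @bmeasD _ _ _ h k.
have bB (h k : Y -> R) := @bmeasB _ _ _ h k.
rewrite /energy /sample_energy /dev /deviation.
rewrite -RintD; [|by auto|by auto].
rewrite -!RintZ; [|by auto|by auto].
have b2 (h : Y -> R) : bmeas h -> bmeas (fun q => 2 * h q).
  by move=> bh; apply: bmeasM => //; exact: bmeas_cst.
rewrite -RintD; [|by auto|by auto].
apply: le_Rint; [by auto 10|by auto 10|] => q /=.
move: (sample_mean f s q) (sample_mean g s q) (\int[P]_x f (x, q))
  (\int[P]_x g (x, q)) => a b a' b'.
(* [2 a^2 + 2 (a - a')^2 - a'^2 = (2 a - a')^2]. *)
have := sqr_ge0 (2 * a - a'); have := sqr_ge0 (2 * b - b'); nra.
Qed.

Lemma sample_energy_centered n (s : n.-tuple X) :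
  (forall q, \int[P]_x f (x, q) = 0) -> (forall q, \int[P]_x g (x, q) = 0) ->
  sample_energy s = dev s.
Proof.
move=> l0 u0; rewrite /dev /deviation -RintD.
- by apply: eq_Rintegral => q _; rewrite l0 u0 !subr0.
- by apply/bmeasX2/bmeasB; [exact: bsm|exact: bmeas_Rint2].
- by apply/bmeasX2/bmeasB; [exact: bsm|exact: bmeas_Rint2].
Qed.

End two_deviations.

(** * The uniform distribution on the unit interval *)

Section uniform_distribution.
Variable R : realType.

Definition of_measurableTypeR (x : measurableTypeR R) : R := x.

Lemma measurable_of_measurableTypeR : measurable_fun setT of_measurableTypeR.
Proof. by move=> _ A mA; rewrite setTI. Qed.

HB.instance Definition _ := isMeasurableFun.Build _ _ _ _
  of_measurableTypeR measurable_of_measurableTypeR.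

(* [uniform_prob] lives on [measurableTypeR R], whose measurable structure
   does not unify with the canonical one on [R]. *)
Definition unif01 : probability R R :=
  distribution (uniform_prob (@ltr01 R)) of_measurableTypeR.

Lemma Rint_unif01 (f : R -> R) : bmeas f ->
  \int[uniform_prob (@ltr01 R)]_q f q = \int[unif01]_q f q.
Proof.
move=> bf; by rewrite Rint_distribution//; exact: bf.1.
Qed.

Lemma unif01E (A : set R) : measurable A ->
  unif01 A = lebesgue_measure (A `&` `[0, 1]).
Proof.
move=> mA; rewrite /unif01/= /distribution/= /pushforward/=.
rewrite /uniform_prob integral_uniform_pdf.
rewrite (eq_integral (cst 1%E)); last first.
  move=> x; rewrite inE/= in_itv/= => -[_ x01].
  by rewrite /uniform_pdf x01 subr0 invr1.
by rewrite integral_cst ?mul1e//; apply: measurableI => //; exact: measurable_itv.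
Qed.
End uniform_distribution.

(** * ATB as the energy of two bounded bins *)

Section atb.
Variable R : realType.
Implicit Types (J : probability (R * bool)%type R) (x : R * bool) (q : R).

(* Agrees with the identity on [0, 1] and keeps all the integrands bounded
   outside of [unit_domain]. *)
Definition clamp (v : R) : R := Num.max 0 (Num.min 1 v).

Lemma clamp_ge0 v : 0 <= clamp v.
Proof. by rewrite le_max lexx. Qed.

Lemma clamp_le1 v : clamp v <= 1.
Proof. by rewrite ge_max ler01 ge_min lexx. Qed.

Lemma clamp_id v : 0 <= v <= 1 -> clamp v = v.
Proof. by move=> /andP[v0 v1]; rewrite /clamp min_r// max_r. Qed.

Lemma measurable_clamp : measurable_fun setT clamp.
Proof.
apply: measurable_maxr; first exact: measurable_cst.
by apply: measurable_minr => //; exact: measurable_cst.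
Qed.

Lemma unit_domainP x : unit_domain x <-> 0 <= x.1 <= 1.
Proof.
rewrite /unit_domain/= in_itv/=; split; [by case|by []].
Qed.

Lemma measurable_unit_domain : measurable (@unit_domain R).
Proof. by apply: measurableX; first exact: measurable_itv. Qed.

Lemma clamp_unit x : unit_domain x -> clamp x.1 = x.1.
Proof. by move=> /unit_domainP/clamp_id. Qed.

Lemma measurable_clamp1 : measurable_fun setT (fun x => clamp x.1).
Proof. exact: measurableT_comp measurable_clamp _. Qed.

Lemma bmeas_clamp1 : bmeas (fun x => clamp x.1).
Proof.
split; first exact: measurable_clamp1.
by exists 1 => x; rewrite ger0_norm ?clamp_ge0 ?clamp_le1.
Qed.

Lemma bmeas_label : bmeas (@label R).
Proof. exact: bmeas_bool. Qed.

Definition residual x : R := clamp x.1 - label x.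

Lemma bmeas_residual : bmeas residual.
Proof. exact: bmeasB bmeas_clamp1 bmeas_label. Qed.

Lemma residual_le1 x : `|residual x| <= 1.
Proof.
rewrite /residual /label; have := clamp_ge0 x.1; have := clamp_le1 x.1.
by rewrite ler_norml; case: x.2 => /= *; lra.
Qed.

Definition lower_bin (z : (R * bool) * R) : R :=
  residual z.1 * (clamp z.1.1 < z.2)%R%:R.

Definition upper_bin (z : (R * bool) * R) : R :=
  residual z.1 * (z.2 <= clamp z.1.1)%R%:R.

Let mclampz : measurable_fun setT (fun z : (R * bool) * R => clamp z.1.1).
Proof. exact: measurableT_comp measurable_clamp1 _. Qed.

Lemma bmeas_lower_bin : bmeas lower_bin.
Proof.
apply: bmeasM; first by apply: bmeas_comp bmeas_residual.
by apply: bmeas_bool; exact: measurable_fun_ltr.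
Qed.

Lemma bmeas_upper_bin : bmeas upper_bin.
Proof.
apply: bmeasM; first by apply: bmeas_comp bmeas_residual.
by apply: bmeas_bool; exact: measurable_fun_ler.
Qed.

Lemma lower_bin_le1 z : `|lower_bin z| <= 1.
Proof.
rewrite /lower_bin normrM -[leRHS]mulr1 ler_pM ?residual_le1//.
by case: (_ < _); rewrite ?normr1 ?normr0.
Qed.

Lemma upper_bin_le1 z : `|upper_bin z| <= 1.
Proof.
rewrite /upper_bin normrM -[leRHS]mulr1 ler_pM ?residual_le1//.
by case: (z.2 <= _); rewrite ?normr1 ?normr0.
Qed.

Local Notation U := (unif01 R).

Lemma ATBE J : on_unit J -> ATB J =
  energy J U lower_bin upper_bin.
Proof.
move=> J1; have mU := measurable_unit_domain.
have mr : measurable_fun setT (fun x => x.1 - label x).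
  by apply: measurable_funB => //; exact: bmeas_label.1.
have mlt (q : R) : measurable_fun setT (fun x : R * bool => (x.1 < q)%R%:R : R).
  by apply: (@bmeas_bool _ _ _ (fun x : R * bool => x.1 < q) _).1; exact: measurable_fun_ltr.
have mge (q : R) : measurable_fun setT (fun x : R * bool => (q <= x.1)%R%:R : R).
  by have [] := @bmeas_bool _ _ R (fun x : R * bool => q <= x.1)
    (measurable_fun_ler (measurable_cst q) measurable_fst).
rewrite /energy -Rint_unif01; last first.
  by apply: bmeasD; apply: bmeasX2; apply: bmeas_Rint2;
    [exact: bmeas_lower_bin|exact: bmeas_upper_bin].
apply: eq_Rintegral => q _; congr (_ ^+ 2 + _ ^+ 2); apply: (Rint_ae_eq mU J1).
- apply: measurable_funM => //.
- exact (bmeas_pair2 bmeas_lower_bin q).1.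
- by move=> x /clamp_unit x1; rewrite /lower_bin /residual /= x1.
- apply: measurable_funM => //.
- exact (bmeas_pair2 bmeas_upper_bin q).1.
- by move=> x /clamp_unit x1; rewrite /upper_bin /residual /= x1.
Qed.

(** Written directly in terms of the sample points, which makes it measurable in [s] on the whole
    sample space; it is ATB of the empirical distribution when all points lie in [unit_domain]. *)
Definition ATB_sample n (s : n.-tuple (R * bool)%type) : R :=
  sample_energy U lower_bin upper_bin s.

Lemma bmeas_ATB_sample n : bmeas (@ATB_sample n).
Proof.
exact: (bmeas_sample_energy U (@bmeas_lower_bin) (@bmeas_upper_bin) n).
Qed.

Lemma ATB_empirical n (s : n.-tuple (R * bool)%type) : (0 < n)%N ->
  (forall i, unit_domain (tnth s i)) -> ATB (empirical_dist s) = ATB_sample s.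
Proof.
move=> n0 us; rewrite ATBE; last first.
  by apply: empirical_support => //; exact: measurable_unit_domain.
apply: eq_Rintegral => q _.
by congr (_ ^+ 2 + _ ^+ 2); rewrite /empirical_dist Rint_empirical//;
  apply: bmeas_pair2; [exact: bmeas_lower_bin|exact: bmeas_upper_bin].
Qed.

Lemma measurable_acceptance_ATB : measurable_acceptance (@ATB R).
Proof.
move=> n beta n0.
rewrite [X in measurable X](_ : _ =
    [set s : n.-tuple (R * bool)%type | forall i, unit_domain (tnth s i)] `&`
    @ATB_sample n @^-1` `]-oo, beta]); last first.
  apply/seteqP; split => s /=; rewrite in_itv/=.
    by move=> [us]; rewrite ATB_empirical.
  by move=> [us]; rewrite /accept_event/= ATB_empirical.
apply: measurableI; first exact: (measurable_forall_tnth measurable_unit_domain).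
have [mA _] := @bmeas_ATB_sample n.
rewrite -[X in measurable X]setTI; apply: mA; first exact: measurableT.
exact: measurable_itv.
Qed.

Lemma calibration_measure_ATB : calibration_measure (@ATB R).
Proof.
split=> [J J' _ _ JJ'|J _]; last first.
  by apply: Rintegral_ge0 => q _; rewrite addr_ge0// sqr_ge0.
apply: eq_Rintegral => q _.
by congr (_ ^+ 2 + _ ^+ 2); exact: eq_measure_Rint.
Qed.

Definition ATB_deviation J n (s : n.-tuple (R * bool)%type) : R :=
  deviation J U lower_bin s + deviation J U upper_bin s.

Lemma ATB_deviation_gt J n : (0 < n)%N ->
  fine (iid J n [set s | 8 / n%:R < ATB_deviation J s]) <= 4^-1.
Proof.
exact: (deviation_tail J U bmeas_lower_bin bmeas_upper_bin lower_bin_le1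
  upper_bin_le1).
Qed.

Lemma ATB_le_sample J n (s : n.-tuple (R * bool)%type) : on_unit J ->
  ATB J <= 2 * ATB_sample s + 2 * ATB_deviation J s.
Proof.
move=> J1; rewrite ATBE//.
exact: (energy_le_sample J U bmeas_lower_bin bmeas_upper_bin).
Qed.

Lemma ATB_sample_centered J n (s : n.-tuple (R * bool)%type) :
  (forall q, \int[J]_x lower_bin (x, q) = 0) ->
  (forall q, \int[J]_x upper_bin (x, q) = 0) ->
  ATB_sample s = ATB_deviation J s.
Proof. exact: (sample_energy_centered U bmeas_lower_bin bmeas_upper_bin). Qed.

End atb.

(** * Calibration expressed by moments *)

Section calibration_moments.
Variable R : realType.
Implicit Types (J : probability (R * bool)%type R) (A : set R).

Lemma bmeas_indic_fst A : measurable A -> bmeas (fun x : R * bool => \1_A x.1 : R).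
Proof. by move=> mA; exact: (bmeas_comp measurable_fst (bmeas_indic R mA)). Qed.

Let restr J A (f : R * bool -> R) :
  \int[J]_(x in fst @^-1` A) f x = \int[J]_x (f x * \1_A x.1).
Proof.
rewrite Rintegral_mkcond; apply: eq_Rintegral => x _.
rewrite patchE indicE (_ : (x \in _) = (x.1 \in A)); last first.
  by apply/idP/idP => /set_mem h; exact/mem_set.
by case: ifPn; rewrite ?mulr1 ?mulr0.
Qed.

(** The version of the conditional expectation is [clamp]: it is bounded, hence integrable, and is
    the identity on [[0, 1]]. *)
Lemma calibrated_from_moments J : on_unit J ->
  (forall A, measurable A ->
    \int[J]_x (label x * \1_A x.1) = \int[J]_x (clamp x.1 * \1_A x.1)) ->
  calibrated J.
Proof.
move=> J1 mom; exists (@clamp R).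
  split=> [||A mA]; first exact: measurable_clamp.
    exact: (bmeas_integrable J (@bmeas_clamp1 R)).
  by rewrite !restr mom.
have mU := @measurable_unit_domain R.
have JC : J (~` @unit_domain R) = 0%E.
  by rewrite probability_setC// [X in (1 - X)%E]J1 subee.
exists (~` @unit_domain R); split => //; first exact: measurableC.
by move=> x /= nx ux; apply: nx; exact: clamp_unit.
Qed.

(** Almost surely [g v = v = clamp v], so the defining identity of the conditional expectation can
    be read with [clamp] in place of [g]. *)
Lemma calibrated_moments J A : on_unit J -> calibrated J -> measurable A ->
  \int[J]_x (residual x * \1_A x.1) = 0.
Proof.
move=> J1 [g [mg ig gE] gid] mA; have mU := @measurable_unit_domain R.
have bA := bmeas_indic_fst mA.
have : \int[J]_x (label x * \1_A x.1) = \int[J]_x (clamp x.1 * \1_A x.1).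
  have := gE A mA; rewrite !restr => ->.
  rewrite /Rintegral; congr fine; apply: ae_eq_integral => //.
  - apply/measurable_EFinP/measurable_funM => //; last exact: bA.1.
    exact: measurableT_comp mg _.
  - by apply/measurable_EFinP; exact: (bmeasM (@bmeas_clamp1 R) bA).1.
  have JC : J (~` @unit_domain R) = 0%E.
    by rewrite probability_setC// [X in (1 - X)%E]J1 subee.
  have : {ae J, forall x, unit_domain x}.
    by exists (~` @unit_domain R); split => //; exact: measurableC.
  move: gid; apply: filterS2 => x gx ux _.
  by rewrite gx clamp_unit.
move=> lE; rewrite /residual.
under eq_Rintegral do rewrite mulrBl.
by rewrite RintB ?lE ?subrr//; apply: bmeasM => //;
  [exact: bmeas_clamp1|exact: bmeas_label].
Qed.

(** On [unit_domain] the two bins are the residual times the indicators of the half-lines below and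
    above [q]. *)
Lemma calibrated_bins J q : on_unit J -> calibrated J ->
  \int[J]_x lower_bin (x, q) = 0 /\ \int[J]_x upper_bin (x, q) = 0.
Proof.
move=> J1 cJ; have mU := @measurable_unit_domain R.
have h (f : R * bool -> R) A : bmeas f -> measurable A ->
    (forall x, unit_domain x -> f x = residual x * \1_A x.1) ->
    \int[J]_x f x = 0.
  move=> bf mA fE; rewrite -(calibrated_moments J1 cJ mA).
  apply: (Rint_ae_eq mU J1) => //; first exact: bf.1.
  exact: (bmeasM (@bmeas_residual R) (bmeas_indic_fst mA)).1.
split; [apply: (h _ `]-oo, q[%classic)|apply: (h _ `[q, +oo[%classic)].
- exact: bmeas_pair2 (@bmeas_lower_bin R) q.
- exact: measurable_itv.
- by move=> x ux; rewrite /lower_bin/= clamp_unit// indicE mem_setE in_itv.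
- exact: bmeas_pair2 (@bmeas_upper_bin R) q.
- exact: measurable_itv.
- by move=> x ux; rewrite /upper_bin/= clamp_unit// indicE mem_setE in_itv/= andbT.
Qed.

(** Used to transfer calibration to the marginal of a coupling, which is known only through its
    values on measurable sets. *)
Lemma calibrated_eq J J' : (forall A : set (R * bool), measurable A -> J A = J' A) ->
  on_unit J -> calibrated J -> calibrated J'.
Proof.
move=> JJ' J1 cJ; apply: calibrated_from_moments.
  by rewrite /on_unit -JJ'//; exact: measurable_unit_domain.
move=> A mA; rewrite -!(eq_measure_Rint _ measurableT JJ').
have bA := bmeas_indic_fst mA.
apply/esym/eqP; rewrite -subr_eq0 -RintB.
- rewrite -[X in _ == X](calibrated_moments J1 cJ mA); apply/eqP.
  by apply: eq_Rintegral => x _; rewrite mulrBl.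
- by apply: bmeasM => //; exact: bmeas_clamp1.
- by apply: bmeasM => //; exact: bmeas_label.
Qed.

End calibration_moments.

Section uniform.
Variable R : realType.
Local Notation U := (unif01 R).
Implicit Types (a b c : R).

Lemma unif01_itv01 : U `[0, 1[%classic = 1%E.
Proof.
rewrite unif01E; last exact: measurable_itv.
rewrite setIidl; last by apply: subset_itvl; rewrite bnd_simp.
by rewrite lebesgue_measure_itv/= lte01 oppr0 adde0.
Qed.

Lemma bmeas_lt c : bmeas (fun s : R => (s < c)%R%:R : R).
Proof. by apply: bmeas_bool; apply: measurable_fun_ltr => //; exact: measurable_cst. Qed.

Lemma bmeas_gt c : bmeas (fun s : R => (c < s)%R%:R : R).
Proof. by apply: bmeas_bool; apply: measurable_fun_ltr => //; exact: measurable_cst. Qed.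

Lemma unif01_lt c : 0 <= c <= 1 -> U `]-oo, c[%classic = c%:E.
Proof.
move=> /andP[c0 c1]; rewrite unif01E; last exact: measurable_itv.
rewrite (_ : _ `&` _ = `[0, c[%classic); last first.
  apply/seteqP; split=> x /=; rewrite !in_itv/=.
    by move=> [-> /andP[->]].
  by move=> /andP[-> xc]; rewrite xc (le_trans (ltW xc)).
rewrite lebesgue_measure_itv/= lte_fin; case: ltP; first by rewrite oppr0 adde0.
by move=> c0'; congr EFin; apply/eqP; rewrite eq_le c0 c0'.
Qed.

Lemma Rint_unif01_lt c : 0 <= c <= 1 -> \int[U]_s (s < c)%R%:R = c.
Proof.
move=> c01; transitivity (fine (U `]-oo, c[%classic)); last by rewrite unif01_lt.
rewrite -Rint_indic; last exact: measurable_itv.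
by apply: eq_Rintegral => s _; rewrite indicE mem_setE in_itv.
Qed.

Lemma Rint_unif01_dist_lt a b : 0 <= a <= 1 -> 0 <= b <= 1 ->
  \int[U]_s `|(s < a)%R%:R - (s < b)%R%:R| = `|a - b| :> R.
Proof.
wlog ab : a b / a <= b => [hw a01 b01|a01 b01].
  have [ab|/ltW ba] := leP a b; first exact: hw.
  by rewrite distrC -hw//; apply: eq_Rintegral => s _; rewrite distrC.
transitivity (\int[U]_s ((s < b)%R%:R - (s < a)%R%:R)).
  apply: eq_Rintegral => s _; rewrite distrC ger0_norm// subr_ge0 ler_nat.
  by case: (ltP s a) => // sa; rewrite (lt_le_trans sa).
rewrite RintB ?Rint_unif01_lt//; [|exact: bmeas_lt|exact: bmeas_lt].
by rewrite distrC ger0_norm// subr_ge0.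
Qed.

Lemma Rint_unif01_gt c : 0 <= c <= 1 -> \int[U]_s (c < s)%R%:R = 1 - c.
Proof.
move=> c01; transitivity (fine (U `]c, +oo[%classic)).
  rewrite -Rint_indic; last exact: measurable_itv.
  by apply: eq_Rintegral => s _; rewrite indicE mem_setE in_itv/= andbT.
rewrite unif01E; last exact: measurable_itv.
move: c01 => /andP[c0 c1].
rewrite (_ : _ `&` _ = `]c, 1]%classic); last first.
  apply/seteqP; split=> x /=; rewrite !in_itv/= ?andbT.
    by move=> [-> /andP[_ ->]].
  by move=> /andP[cx ->]; rewrite cx (le_trans c0 (ltW cx)).
rewrite lebesgue_measure_itv/= lte_fin; case: ltP => //= c1'.
by apply/eqP; rewrite eq_sym subr_eq0 eq_le c1 c1'.
Qed.

(** The distance of two predictions is the measure of the thresholds that separate them; this is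
    what brings distribution functions into the cost of a coupling. *)
Lemma Rint_unif01_dist_gt a b : 0 <= a <= 1 -> 0 <= b <= 1 ->
  \int[U]_s `|(a < s)%R%:R - (b < s)%R%:R| = `|a - b| :> R.
Proof.
wlog ab : a b / a <= b => [hw a01 b01|a01 b01].
  have [ab|/ltW ba] := leP a b; first exact: hw.
  by rewrite distrC -hw//; apply: eq_Rintegral => s _; rewrite distrC.
transitivity (\int[U]_s ((a < s)%R%:R - (b < s)%R%:R)).
  apply: eq_Rintegral => s _; rewrite ger0_norm// subr_ge0 ler_nat.
  by case: (ltP b s) => // bs; rewrite (le_lt_trans ab).
rewrite RintB ?Rint_unif01_gt//; [|exact: bmeas_gt|exact: bmeas_gt].
by rewrite distrC ger0_norm ?subr_ge0//; ring.
Qed.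

End uniform.

(** * Quantile coupling *)

Section quantile.
Variables (R : realType) (P : probability R R) (M : R).
Hypotheses (M0 : 0 <= M) (P0M : P `[0, M]%classic = 1%E).
Implicit Types (s x y : R).
Local Notation U := (unif01 R).

(* The strict inequality makes it left-continuous, and matches the bins
   [v < q] of [ATB]. *)
Definition cdf_lt x : R := fine (P `]-oo, x[%classic).

Lemma cdf_lt_EFin x : P `]-oo, x[%classic = (cdf_lt x)%:E.
Proof. by rewrite /cdf_lt fineK// fin_num_measure//; exact: measurable_itv. Qed.

Lemma cdf_lt_ge0 x : 0 <= cdf_lt x.
Proof. exact: fine_ge0. Qed.

Lemma cdf_lt_le1 x : cdf_lt x <= 1.
Proof.
by rewrite -lee_fin -cdf_lt_EFin; apply: probability_le1; exact: measurable_itv.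
Qed.

Lemma cdf_lt_nd : {homo cdf_lt : x y / x <= y}.
Proof.
move=> x y xy; rewrite -lee_fin -!cdf_lt_EFin; apply: le_measure.
- by rewrite inE; exact: measurable_itv.
- by rewrite inE; exact: measurable_itv.
- by apply: subset_itvl; rewrite bnd_simp.
Qed.

Lemma cdf_lt_eq0 x : x <= 0 -> cdf_lt x = 0.
Proof.
move=> x0; apply/eqP; rewrite eq_le cdf_lt_ge0 andbT -lee_fin -cdf_lt_EFin.
have PC0 : P (~` `[0, M]%classic) = 0%E.
  rewrite probability_setC; last exact: measurable_itv.
  by rewrite [X in (1 - X)%E]P0M subee.
apply: (@le_trans _ _ (P (~` `[0, M]%classic))); last by rewrite PC0.
apply: le_measure; rewrite ?inE; first exact: measurable_itv.
  by apply: measurableC; exact: measurable_itv.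
move=> y /=; rewrite !in_itv/= => yx /andP[y0 _].
by have := lt_le_trans yx x0; rewrite ltNge y0.
Qed.

Lemma cdf_lt_eq1 x : M < x -> cdf_lt x = 1.
Proof.
move=> Mx; apply/eqP; rewrite eq_le cdf_lt_le1/= -lee_fin -cdf_lt_EFin.
apply: (@le_trans _ _ (P `[0, M]%classic)); first by rewrite P0M.
apply: le_measure; rewrite ?inE; [exact: measurable_itv| |].
  exact: measurable_itv.
by move=> y /=; rewrite !in_itv/= => /andP[_ yM]; exact: le_lt_trans Mx.
Qed.

(** Continuity from below: the half-line below [y] is the increasing union of the half-lines below
    [y - 1 / (n + 1)]. *)
Lemma cdf_lt_left_continuous s y :
  (forall x, x < y -> cdf_lt x <= s) -> cdf_lt y <= s.
Proof.
move=> ys; pose F n := `]-oo, y - n.+1%:R^-1[%classic : set R.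
have nS n : 0 < n.+1%:R^-1 :> R by rewrite invr_gt0.
have FU : `]-oo, y[%classic = \bigcup_n F n.
  apply/seteqP; split => [x|x [n _]] /=; rewrite /F/= !in_itv/=.
    rewrite -subr_gt0 => /ltr_add_invr[n]; rewrite add0r => nxy.
    by exists n => //=; rewrite in_itv/= ltrBrDr addrC -ltrBrDr.
  by move=> /lt_trans; apply; rewrite ltrBlDr ltrDl.
have Fcvg : P (F n) @[n --> \oo] --> P (\bigcup_n F n).
  apply: nondecreasing_cvg_mu => [n||m n mn]; first exact: measurable_itv.
    by apply: bigcup_measurable => n _; exact: measurable_itv.
  apply/subsetPset; apply: subset_itvl; rewrite bnd_simp lerB// lef_pV2 ?posrE//.
  by rewrite ler_nat.
rewrite -lee_fin -cdf_lt_EFin FU -(cvg_lim _ Fcvg)//.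
apply: lime_le; first by apply/cvg_ex; eexists; exact: Fcvg.
apply: nearW => n; rewrite /F cdf_lt_EFin lee_fin ys//.
by rewrite ltrBlDr ltrDl.
Qed.

(* The disjunct [x = 0] makes [quantile] total (the other set is empty for
   [s < 0]), hence monotone on the whole line. *)
Definition quantile_set s := [set x | x = 0 \/ 0 <= x <= M /\ cdf_lt x <= s].

Definition quantile s := sup (quantile_set s).

Lemma has_sup_quantile s : has_sup (quantile_set s).
Proof.
split; first by exists 0; left.
by exists M => x [->//|[/andP[]]].
Qed.

Lemma quantile_ge0 s : 0 <= quantile s.
Proof. by apply: ub_le_sup; [exact: (has_sup_quantile s).2|left]. Qed.

Lemma measurable_quantile : measurable_fun setT quantile.
Proof.
apply: nondecreasing_measurable => // s t st.
apply: ge_sup; first exact: (has_sup_quantile s).1.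
move=> x [->|[x0 xs]]; first exact: quantile_ge0.
apply: ub_le_sup; first exact: (has_sup_quantile t).2.
by right; split => //; exact: le_trans st.
Qed.

(** Galois connection between quantile and distribution function. Left continuity gives
    [cdf_lt (quantile s) <= s], and [s < 1] settles the case [M < x], where the distribution
    function is 1. *)
Lemma quantile_lt s x : 0 <= s < 1 -> (quantile s < x) = (s < cdf_lt x).
Proof.
move=> /andP[s0 s1]; have cq : cdf_lt (quantile s) <= s.
  apply: cdf_lt_left_continuous => y yq.
  have [z [->|[_ zs]] yz] := sup_gt (has_sup_quantile s).1 yq.
    by rewrite cdf_lt_eq0// ltW.
  by apply: le_trans zs; apply: cdf_lt_nd; exact: ltW.
apply/idP/idP => [qx|]; last first.
  by apply: contraTT; rewrite -!leNgt => xq; exact: le_trans (cdf_lt_nd xq) cq.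
have x0 : 0 <= x := le_trans (quantile_ge0 s) (ltW qx).
have [xM|Mx] := leP x M; last by rewrite cdf_lt_eq1.
rewrite ltNge; apply/negP => xs; move: qx; rewrite ltNge => /negP; apply.
apply: ub_le_sup; first exact: (has_sup_quantile s).2.
by right; rewrite x0 xM.
Qed.

(** It suffices to compare the two laws on open left half-lines, a generating family closed under
    intersection; there [quantile_lt] turns the preimage into the event [s < cdf_lt x]. *)
Lemma quantile_law (A : set R) : measurable A -> U (quantile @^-1` A) = P A.
Proof.
pose Q : {mfun R >-> R} := HB.pack quantile
  (isMeasurableFun.Build _ _ _ _ quantile measurable_quantile).
apply: (measure_unique (@RGenInftyO.G R) (fun n => `]-oo, n%:R[%classic)
  _ _ _ _ (distribution U Q)).
- exact: RGenInftyO.measurableE.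
- move=> _ _ [x ->] [y ->]; exists (Num.min x y).
  by apply/seteqP; split => z /=; rewrite !in_itv/= lt_min => /andP.
- by move=> n; exists n%:R.
- apply/seteqP; split => // x _; exists (Num.truncn x).+1 => //=.
  by rewrite in_itv/= truncnS_gt.
- move=> _ [x ->]; rewrite [RHS]cdf_lt_EFin.
  transitivity (U `]-oo, cdf_lt x[%classic); last first.
    by rewrite unif01_lt// cdf_lt_ge0 cdf_lt_le1.
  apply: (eq_probability_on _ _ _ (unif01_itv01 R)).
  + rewrite -[X in measurable X]setTI; apply: measurable_quantile => //.
    exact: measurable_itv.
  + exact: measurable_itv.
  + by move=> s /=; rewrite !in_itv/= => s01; rewrite quantile_lt.
- move=> n; rewrite (le_lt_trans _ (ltry 1))//.
  by apply: probability_le1; exact: measurable_itv.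
Qed.

End quantile.

(** * Labelled predictions as points of the line *)

Section encoding.
Variable R : realType.
Implicit Types (J K : probability (R * bool)%type R) (x : R * bool) (z q s : R).
Local Notation U := (unif01 R).

(* Points with different labels land in disjoint intervals, so that one
   quantile coupling on the line matches the labels almost surely as soon as
   the two label means agree. *)
Definition encode x : R := if x.2 then clamp x.1 else 2 + clamp x.1.

(** The cut [3 / 2] lies in the gap between the code intervals [[0, 1]] and [[2, 3]]. *)
Definition decode z : R * bool :=
  if z < 3 / 2 then (clamp z, true) else (clamp (z - 2), false).

Lemma measurable_encode : measurable_fun setT encode.
Proof.
apply: measurable_fun_ifT => //; first exact: measurable_clamp1.
by apply: measurable_funD => //; exact: measurable_clamp1.
Qed.

HB.instance Definition _ := isMeasurableFun.Build _ _ _ _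
  encode measurable_encode.

Lemma measurable_decode : measurable_fun setT decode.
Proof.
apply: measurable_fun_ifT.
- by apply: measurable_fun_ltr => //; exact: measurable_cst.
- by apply: measurable_fun_pair => //; exact: measurable_clamp.
- apply: measurable_fun_pair => //; apply: (measurableT_comp (@measurable_clamp R)).
  by apply: measurable_funB => //; exact: measurable_cst.
Qed.

Lemma encodeK x : unit_domain x -> decode (encode x) = x.
Proof.
case: x => v b ux; have := clamp_unit ux; rewrite /decode /encode /= => vE.
move/unit_domainP : ux => /= /andP[v0 v1].
rewrite vE; case: b; first by rewrite vE ifT//; lra.
by rewrite ifF ?[_ + v]addrC ?addrK ?vE//; apply/negbTE; rewrite -leNgt; lra.
Qed.

Lemma clamp_lt z q : 0 < q <= 1 -> (clamp z < q) = (z < q).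
Proof.
move=> /andP[q0 q1]; rewrite /clamp gt_max q0/= gt_min.
by apply/orP/idP => [[q1'|//]|->]; [have := lt_le_trans q1' q1; rewrite ltxx|right].
Qed.

Lemma encode_lt_low x q : 0 <= q <= 1 ->
  (encode x < q)%R%:R = label x * (clamp x.1 < q)%R%:R :> R.
Proof.
move=> /andP[q0 q1]; rewrite /encode /label; have := clamp_ge0 x.1.
case: x.2 => /= c0; first by rewrite mul1r.
by rewrite mul0r ltNge (_ : q <= _)//; lra.
Qed.

(** Every point with label 1 has its code below 2 and is counted in full; only points with label 0
    are compared with [q]. *)
Lemma encode_lt_high x q : 0 <= q <= 1 ->
  (encode x < q + 2)%R%:R = label x + (1 - label x) * (clamp x.1 < q)%R%:R :> R.
Proof.
move=> /andP[q0 q1]; rewrite /encode /label; have := clamp_le1 x.1.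
case: x.2 => /= c1; first by rewrite subrr mul0r addr0 (_ : _ < _)//; lra.
by rewrite subr0 mul1r add0r addrC ltrD2r.
Qed.

Lemma encode_lt_mid x : (encode x < 3 / 2)%R%:R = label x :> R.
Proof.
rewrite /encode /label; have := clamp_le1 x.1; have := clamp_ge0 x.1.
case: x.2 => /= c0 c1; first by rewrite (_ : _ < _)//; lra.
by rewrite ltNge (_ : _ <= _)//; lra.
Qed.

Lemma encode_itv J : distribution J encode `[0, 3]%classic = 1%E.
Proof.
rewrite -(probability_setT J) /distribution/= /pushforward/=; congr (J _).
apply/seteqP; split => // x _ /=; rewrite in_itv/= /encode.
have := clamp_le1 x.1; have := clamp_ge0 x.1; case: x.2 => c0 c1; lra.
Qed.

Definition code_cdf J z : R := cdf_lt (distribution J encode) z.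

Lemma bmeas_encode_lt z : bmeas (fun x => (encode x < z)%R%:R : R).
Proof.
apply: bmeas_bool; apply: measurable_fun_ltr; first exact: measurable_encode.
exact: measurable_cst.
Qed.

Lemma code_cdfE J z : code_cdf J z = \int[J]_x (encode x < z)%R%:R.
Proof.
have mA : measurable (encode @^-1` `]-oo, z[%classic).
  rewrite -[X in measurable X]setTI; apply: measurable_encode => //.
transitivity (\int[J]_x (\1_(encode @^-1` `]-oo, z[%classic) x : R)).
  by rewrite Rint_indic.
apply: eq_Rintegral => x _; rewrite indicE.
congr (nat_of_bool _)%:R; apply/idP/idP => [/set_mem|h]/=; first by rewrite in_itv.
by apply/mem_set; rewrite /= in_itv.
Qed.

Lemma code_cdf_mid J : code_cdf J (3 / 2) = \int[J]_x label x.
Proof.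
by rewrite code_cdfE; apply: eq_Rintegral => x _; exact: encode_lt_mid.
Qed.

Lemma code_cdf_itv J z : 0 <= code_cdf J z <= 1.
Proof. by rewrite /code_cdf cdf_lt_ge0 cdf_lt_le1. Qed.

Lemma measurable_code_cdf J : measurable_fun setT (code_cdf J).
Proof.
by apply: nondecreasing_measurable => // x y xy; exact: cdf_lt_nd.
Qed.

Definition quantile_coding J : R -> R := quantile (distribution J encode) 3.

Definition decoded_quantile J s : R * bool := decode (quantile_coding J s).

Lemma measurable_decoded_quantile J : measurable_fun setT (decoded_quantile J).
Proof.
apply: (measurableT_comp measurable_decode).
by apply: measurable_quantile.
Qed.

Lemma decoded_quantile_law J (A : set (R * bool)) : on_unit J -> measurable A ->
  U (decoded_quantile J @^-1` A) = J A.
Proof.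
move=> J1 mA; have mD : measurable (decode @^-1` A).
  by rewrite -[X in measurable X]setTI; exact: measurable_decode.
transitivity (distribution J encode (decode @^-1` A)).
  exact: (quantile_law (ler0n R 3) (encode_itv J) mD).
rewrite /distribution/= /pushforward/=.
apply: (eq_probability_on _ mA (@measurable_unit_domain R) J1).
  by rewrite -[X in measurable X]setTI; exact: measurable_encode.
by move=> x ux /=; rewrite encodeK.
Qed.

Lemma quantile_coding_lt J s z : 0 <= s < 1 ->
  (quantile_coding J s < z) = (s < code_cdf J z).
Proof. by move=> s01; apply: quantile_lt => //; exact: encode_itv. Qed.

(** The label is decided by the cut at [3 / 2], below which the code has mass [E y]. Two laws with
    equal label means thus give the same label for the same [s]. *)
Lemma decoded_label J s : 0 <= s < 1 ->
  (decoded_quantile J s).2 = (s < \int[J]_x label x).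
Proof.
move=> s01; rewrite -code_cdf_mid -quantile_coding_lt// /decoded_quantile /decode.
by case: ifP.
Qed.

Lemma decoded_lt J s q : 0 <= s < 1 -> 0 < q <= 1 ->
  ((decoded_quantile J s).1 < q) =
  if s < \int[J]_x label x then s < code_cdf J q else s < code_cdf J (q + 2).
Proof.
move=> s01 q01; rewrite -code_cdf_mid -!quantile_coding_lt// /decoded_quantile /decode.
by case: ifP => _ /=; rewrite clamp_lt// ltrBlDr.
Qed.

Lemma decoded_itv J s : 0 <= (decoded_quantile J s).1 <= 1.
Proof.
by rewrite /decoded_quantile /decode; case: ifP => _ /=; rewrite clamp_ge0 clamp_le1.
Qed.

End encoding.

(** * Monotone coupling of two laws with equal label means *)

Section quantile_coupling.
Variables (R : realType) (J K : probability (R * bool)%type R).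
Hypotheses (J1 : on_unit J) (K1 : on_unit K) (cK : calibrated K).
Hypothesis JK : \int[J]_x label x = \int[K]_x label x.
Local Notation U := (unif01 R).

(** One uniform [s] drives both laws; the new prediction comes from [K], while the old prediction
    and the label come from [J]. *)
Definition quantile_pair (s : R) : R * (R * bool) :=
  ((decoded_quantile K s).1, decoded_quantile J s).

Lemma measurable_quantile_pair : measurable_fun setT quantile_pair.
Proof.
apply: measurable_fun_pair; last exact: measurable_decoded_quantile.
exact: measurableT_comp (@measurable_decoded_quantile R K).
Qed.

Let Z : {mfun R >-> (R * (R * bool))%type} := HB.pack quantile_pair
  (isMeasurableFun.Build _ _ _ _ quantile_pair measurable_quantile_pair).

Let Pi := distribution U Z.

Let mproj (A : set (R * bool)) : measurable A ->
  measurable [set s | A ((decoded_quantile K s).1, (decoded_quantile J s).2)].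
Proof.
move=> mA; rewrite -[X in measurable X]setTI.
exact: (measurableT_comp (@measurable_proj_uy R) measurable_quantile_pair).
Qed.

(** The label is drawn from [J], but by [decoded_label] and [JK] it coincides with the one drawn
    from [K] for [s] in [[0, 1[]. *)
Lemma quantile_pair_proj (A : set (R * bool)) : measurable A ->
  K A = distribution Pi (@proj_uy R) A.
Proof.
move=> mA; rewrite -(decoded_quantile_law K1 mA).
apply: (eq_probability_on _ (mproj mA) _ (unif01_itv01 R)).
- by rewrite -[X in measurable X]setTI; exact: measurable_decoded_quantile.
- exact: measurable_itv.
move=> s /=; rewrite in_itv/= => s01.
rewrite [decoded_quantile K s]surjective_pairing.
by rewrite !decoded_label// JK.
Qed.

Lemma quantile_pair_coupling : calibrated_coupling J Pi.
Proof.
split.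
- by move=> A mA; exact: decoded_quantile_law.
- exact: etrans (esym (quantile_pair_proj (@measurable_unit_domain R))) K1.
- exact: (calibrated_eq quantile_pair_proj K1 cK).
Qed.

Let bu : bmeas (fun s => (decoded_quantile K s).1).
Proof.
split; first exact: measurableT_comp (@measurable_decoded_quantile R K).
by exists 1 => s; rewrite ler_norml; have := decoded_itv K s; lra.
Qed.

Let bv : bmeas (fun s => (decoded_quantile J s).1).
Proof.
split; first exact: measurableT_comp (@measurable_decoded_quantile R J).
by exists 1 => s; rewrite ler_norml; have := decoded_itv J s; lra.
Qed.

Let blt (f : R -> R) : measurable_fun setT f ->
  bmeas (fun z : R * R => (f z.1 < z.2)%R%:R : R).
Proof.
move=> mf; apply: bmeas_bool; apply: measurable_fun_ltr => //.
exact: measurableT_comp mf _.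
Qed.

Let bgt (f : R -> R) : measurable_fun setT f ->
  bmeas (fun z : R * R => (z.1 < f z.2)%R%:R : R).
Proof.
move=> mf; apply: bmeas_bool; apply: measurable_fun_ltr => //.
exact: measurableT_comp mf _.
Qed.

Let bcdf (L : probability (R * bool)%type R) (f : R -> R) :
  measurable_fun setT f -> bmeas (fun q : R => code_cdf L (f q)).
Proof.
move=> mf; split; first exact: measurableT_comp (@measurable_code_cdf R L) mf.
by exists 1 => q; rewrite ler_norml; have := code_cdf_itv L (f q); lra.
Qed.

(** Write [|u - v|] as the measure of the thresholds [q] separating [u] and [v], express each
    comparison with [q] as a comparison of [s] with a distribution function, then exchange the
    integrals and integrate [s] out. *)
Lemma quantile_pair_cost :
  \int[Pi]_x `|x.1 - x.2.1| <=
  \int[U]_q (`|code_cdf J q - code_cdf K q| + `|code_cdf J (q + 2) - code_cdf K (q + 2)|).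
Proof.
rewrite Rint_distribution/=; last first.
- exact: (bmeas_norm (bmeasB bu bv)).
- apply: measurableT_comp => //; apply: measurable_funB => //.
  exact: measurableT_comp.
pose F (z : R * R) : R := `|((decoded_quantile K z.1).1 < z.2)%R%:R -
                            ((decoded_quantile J z.1).1 < z.2)%R%:R|.
pose G (z : R * R) : R := `|(z.1 < code_cdf J z.2)%R%:R - (z.1 < code_cdf K z.2)%R%:R| +
  `|(z.1 < code_cdf J (z.2 + 2))%R%:R - (z.1 < code_cdf K (z.2 + 2))%R%:R|.
have bF : bmeas F := bmeas_norm (bmeasB (blt bu.1) (blt bv.1)).
have mc L := @measurable_code_cdf R L.
have mshift L : measurable_fun setT (fun q : R => code_cdf L (q + 2)).
  apply: (measurableT_comp (mc L)).
  by apply: measurable_funD => //; exact: measurable_cst.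
have bG : bmeas G := bmeasD (bmeas_norm (bmeasB (bgt (mc J)) (bgt (mc K))))
  (bmeas_norm (bmeasB (bgt (mshift J)) (bgt (mshift K)))).
have m01 : measurable (`[0, 1[%classic : set R) by exact: measurable_itv.
have U01 := unif01_itv01 R.
apply: (@le_trans _ _ (\int[U]_s \int[U]_q F (s, q))).
  rewrite le_eqVlt; apply/orP; left; apply/eqP; apply: eq_Rintegral => s _.
  by rewrite /F/= Rint_unif01_dist_gt// decoded_itv.
apply: (@le_trans _ _ (\int[U]_s \int[U]_q G (s, q))).
  apply: (le_Rint_on m01 U01); [exact: bmeas_Rint1|exact: bmeas_Rint1|].
  move=> s /=; rewrite in_itv/= => s01.
  apply: (le_Rint_on m01 U01); [exact: bmeas_pair1|exact: bmeas_pair1|].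
  move=> q /=; rewrite in_itv/= => /andP[q0 q1].
  (* The value [q = 0] is treated apart because [decoded_lt] requires [0 < q]; there no prediction
     lies below [q] and [F] vanishes. *)
  move: q0; rewrite le_eqVlt => /predU1P[<-|q0]; rewrite /F /G /=.
    have [/andP[u0 _] /andP[v0 _]] := (decoded_itv K s, decoded_itv J s).
    by rewrite !ltNge u0 v0 subrr normr0 addr_ge0.
  (* Equal label means make both laws take the same branch, so [F] is one of the two terms of
     [G]. *)
  rewrite !decoded_lt// ?q0 ?(ltW q1)// JK distrC.
  by case: ifP => _; rewrite ?lerDl ?lerDr.
rewrite (Rint_exchange _ _ bG); apply: le_Rint.
- exact: bmeas_Rint2.
- have m2 : measurable_fun setT (fun q : R => q + 2).
    by apply: measurable_funD => //; exact: measurable_cst.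
  have mi : measurable_fun setT (fun q : R => q) by exact: measurable_id.
  exact: (bmeasD (bmeas_norm (bmeasB (bcdf J mi) (bcdf K mi)))
                 (bmeas_norm (bmeasB (bcdf J m2) (bcdf K m2)))).
move=> q; rewrite /G/= RintD.
- by rewrite !Rint_unif01_dist_lt ?code_cdf_itv.
- by apply/bmeas_norm/bmeasB; exact: bmeas_lt.
- by apply/bmeas_norm/bmeasB; exact: bmeas_lt.
Qed.

Lemma lower_distCal_le_cdf :
  lower_distCal J <=
  \int[U]_q (`|code_cdf J q - code_cdf K q| + `|code_cdf J (q + 2) - code_cdf K (q + 2)|).
Proof.
apply: le_trans quantile_pair_cost; apply: ge_inf.
  by exists 0 => _ [Q _ <-]; apply: Rintegral_ge0.
by exists Pi => //; exact: quantile_pair_coupling.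
Qed.

End quantile_coupling.

(** * A calibrated law obtained by redrawing labels *)

Section resampling.
Variables (R : realType) (J : probability (R * bool)%type R) (h : R -> R).
Hypotheses (mh : measurable_fun setT h) (h01 : forall v, 0 <= h v <= 1).
Local Notation U := (unif01 R).

(* Conditionally on the new prediction [h v], the label is redrawn as a
   Bernoulli variable of mean [h v]. *)
Definition resample (z : (R * bool) * R) : R * bool := (h z.1.1, z.2 < h z.1.1).

Lemma measurable_resample : measurable_fun setT resample.
Proof.
have m1 : measurable_fun setT (fun z : (R * bool) * R => h z.1.1).
  by apply: (measurableT_comp mh); exact: measurableT_comp measurable_fst _.
by apply: measurable_fun_pair => //; exact: measurable_fun_ltr.
Qed.

Let Z : {mfun ((R * bool) * R)%type >-> (R * bool)%type} := HB.pack resample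
  (isMeasurableFun.Build _ _ _ _ resample measurable_resample).

Definition resampled : probability (R * bool)%type R := distribution (J \x U)%E Z.

Lemma Rint_resampled (f : R * bool -> R) : bmeas f ->
  \int[resampled]_x f x =
  \int[J]_x (h x.1 * f (h x.1, true) + (1 - h x.1) * f (h x.1, false)).
Proof.
move=> bf; have bfr := bmeas_comp measurable_resample bf.
rewrite /resampled Rint_distribution//; last exact: bf.1.
rewrite (Rint_prod1 _ _ bfr); apply: eq_Rintegral => x _.
transitivity (\int[U]_s ((f (h x.1, true) - f (h x.1, false)) * (s < h x.1)%R%:R
   + f (h x.1, false))).
  by apply: eq_Rintegral => s _; rewrite /resample/=; case: (s < h x.1);
    rewrite ?mulr1 ?mulr0 ?add0r ?subrK.
rewrite RintD; [|by apply: bmeasM; [exact: bmeas_cst|exact: bmeas_lt]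
  |exact: bmeas_cst].
rewrite Rint_cst RintZ; last exact: bmeas_lt.
by rewrite Rint_unif01_lt//; ring.
Qed.

Lemma resampled_on_unit : on_unit resampled.
Proof.
have preT : resample @^-1` (@unit_domain R) = setT.
  by apply/seteqP; split => // z _; apply/unit_domainP; exact: h01.
rewrite /on_unit /resampled /distribution/= /pushforward preT.
exact: probability_setT.
Qed.

(** Once the redrawn label is integrated out, both moments are the [J]-mean of [h v] times the
    indicator of [A] at [h v]. *)
Lemma resampled_calibrated : calibrated resampled.
Proof.
apply: calibrated_from_moments => [|A mA]; first exact: resampled_on_unit.
have bA := bmeas_indic_fst mA.
rewrite !Rint_resampled.
- by apply: eq_Rintegral => x _; rewrite /label/= clamp_id//; ring.
- by apply: bmeasM => //; exact: bmeas_clamp1.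
- by apply: bmeasM => //; exact: bmeas_label.
Qed.

End resampling.

(** * Distance to calibration and ATB *)

Section distCal_ATB.
Variables (R : realType) (J : probability (R * bool)%type R).
Local Notation U := (unif01 R).
Local Notation T := (R * bool)%type.

Let bcl := @bmeas_clamp1 R.
Let blab := @bmeas_label R.
Let bc := @bmeas_cst _ T R.

(** If the predictions are too high on average they are contracted towards 0, otherwise towards 1.
    All of them move in the same direction, so the mean displacement is the absolute value of the
    mean residual. *)
Lemma exists_mean_shift : exists h : R -> R,
  [/\ measurable_fun setT h, forall v, 0 <= h v <= 1,
      \int[J]_x h x.1 = \int[J]_x label x &
      \int[J]_x `|clamp x.1 - h x.1| = `|\int[J]_x residual x| ].
Proof.
have resE : \int[J]_x residual x = \int[J]_x clamp x.1 - \int[J]_x label x.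
  exact: RintB.
have : 0 <= \int[J]_x label x by apply: Rintegral_ge0 => x _; exact: ler0n.
have : \int[J]_x label x <= 1.
  rewrite -[leRHS](Rint_cst J); apply: le_Rint => // x.
  by rewrite /label; case: x.2.
have : 0 <= \int[J]_x clamp x.1 by apply: Rintegral_ge0 => x _; exact: clamp_ge0.
have : \int[J]_x clamp x.1 <= 1.
  by rewrite -[leRHS](Rint_cst J); apply: le_Rint => // x; exact: clamp_le1.
rewrite resE; move: (\int[J]_x label x) => b; set m := \int[J]_x clamp x.1.
move=> m1 m0 b1 b0.
have mcl := @measurable_clamp R.
have [bm|mb] := leP b m.
(* If [m = 0] then [b = 0] as well, and [t] is 0 by the convention on division. *)
- pose t := b / m.
  have tm : t * m = b.
    have [m00|m00] := eqVneq m 0; last by rewrite /t divfK.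
    by apply/eqP; rewrite m00 mulr0 eq_le b0 -m00.
  have t0 : 0 <= t by rewrite divr_ge0.
  have t1 : t <= 1.
    rewrite /t; have [->|m00] := eqVneq m 0; first by rewrite invr0 mulr0.
    by rewrite ler_pdivrMr ?mul1r// lt_neqAle eq_sym m00.
  exists (fun v => t * clamp v); split.
  + by apply: measurable_funM => //; exact: measurable_cst.
  + move=> v; have := clamp_ge0 v; have := clamp_le1 v => c1 c0.
    by rewrite mulr_ge0//= mulr_ile1.
  + by rewrite RintZ.
  + rewrite ger0_norm ?subr_ge0// -[in RHS]tm -[X in _ = X - _]mul1r -mulrBl.
    rewrite -RintZ//; apply: eq_Rintegral => x _.
    rewrite -[X in X - _]mul1r -mulrBl ger0_norm// mulr_ge0 ?clamp_ge0//.
    by rewrite subr_ge0.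
- have m10 : 0 < 1 - m by rewrite subr_gt0 (lt_le_trans mb).
  pose t := (1 - b) / (1 - m).
  have tm : t * (1 - m) = 1 - b by rewrite /t divfK// gt_eqF.
  have t0 : 0 <= t by rewrite divr_ge0 ?subr_ge0// ltW// subr_gt0.
  have t1 : t <= 1 by rewrite /t ler_pdivrMr ?mul1r// lerB// ltW.
  have b1c : bmeas (fun x : T => 1 - clamp x.1) by exact: bmeasB.
  have i1c : \int[J]_x (1 - clamp x.1) = 1 - m by rewrite RintB// Rint_cst.
  exists (fun v => 1 - t * (1 - clamp v)); split.
  + apply: measurable_funB; first exact: measurable_cst.
    apply: measurable_funM; first exact: measurable_cst.
    by apply: measurable_funB => //; exact: measurable_cst.
  + move=> v; have := clamp_ge0 v; have := clamp_le1 v => c1 c0.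
    have : 0 <= t * (1 - clamp v) by rewrite mulr_ge0// subr_ge0.
    have : t * (1 - clamp v) <= 1 by rewrite mulr_ile1// ?subr_ge0 ?lerBlDr ?lerDl.
    by lra.
  + rewrite RintB//; last by apply: bmeasM.
    by rewrite Rint_cst RintZ// i1c tm; ring.
  + rewrite ltr0_norm ?subr_lt0// opprB.
    rewrite (_ : b - m = (1 - t) * (1 - m)); last by rewrite mulrBl tm; ring.
    rewrite -i1c -RintZ//; apply: eq_Rintegral => x _.
    rewrite (_ : clamp x.1 - _ = - ((1 - t) * (1 - clamp x.1))); last by ring.
    by rewrite normrN ger0_norm// mulr_ge0 ?subr_ge0 ?clamp_le1.
Qed.

Variable h : R -> R.
Hypotheses (mh : measurable_fun setT h) (h01 : forall v, 0 <= h v <= 1).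
Hypothesis (hE : \int[J]_x h x.1 = \int[J]_x label x).
Local Notation K := (resampled J mh).

Let bh : bmeas (fun x : T => h x.1).
Proof.
split; first exact: measurableT_comp mh _.
by exists 1 => x; rewrite ler_norml; have := h01 x.1; lra.
Qed.

Lemma label_resampled : \int[J]_x label x = \int[K]_x label x.
Proof.
rewrite Rint_resampled// -hE; apply: eq_Rintegral => x _.
by rewrite /label/=; ring.
Qed.

Let bltc q : bmeas (fun x : T => (clamp x.1 < q)%R%:R : R).
Proof.
by apply: (bmeas_comp (@measurable_clamp1 R) (bmeas_lt q)).
Qed.

Let blth q : bmeas (fun x : T => (h x.1 < q)%R%:R : R).
Proof. exact: (bmeas_comp bh.1 (bmeas_lt q)). Qed.

Let A q := \int[J]_x lower_bin (x, q).

(** Bounds, at threshold [z.2], the effect of replacing [clamp v] by [h v] in a binned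
    expectation. *)
Let gap (z : T * R) : R := `|clamp z.1.1 - h z.1.1| +
  `|(clamp z.1.1 < z.2)%R%:R - (h z.1.1 < z.2)%R%:R|.

Let bgap : bmeas gap.
Proof.
have lt2 (f : T -> R) : bmeas f -> bmeas (fun z : T * R => (f z.1 < z.2)%R%:R : R).
  move=> bf; apply: bmeas_bool; apply: measurable_fun_ltr => //.
  exact: measurableT_comp bf.1 _.
apply: bmeasD; apply/bmeas_norm; last first.
  exact: (bmeasB (lt2 _ bcl) (lt2 _ bh)).
exact: (bmeas_comp measurable_fst (bmeasB bcl bh)).
Qed.

Let gapq q : bmeas (fun x => gap (x, q)).
Proof. exact: bmeas_pair2. Qed.

(** When the indicators differ, a single term [c] or [d] survives, and it is at most 1. *)
Lemma binned_diff_le (c d : R) (l1 l2 : bool) : 0 <= c <= 1 -> 0 <= d <= 1 ->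
  `|c * l1%:R - d * l2%:R| <= `|c - d| + `|l1%:R - l2%:R| :> R.
Proof.
move=> c01 d01; case: l1; case: l2; rewrite ?mulr1 ?mulr0 ?subrr ?subr0 ?sub0r
  ?normrN ?normr0 ?normr1 ?addr0 ?addr_ge0//.
- by rewrite ger0_norm; have := normr_ge0 (c - d); lra.
- by rewrite ger0_norm; have := normr_ge0 (c - d); lra.
Qed.

(** For [K] the redrawn label averages to [h v]. Replacing [h v] by [clamp v] costs at most the mean
    of [gap], and what is left is the binned mean of [label - clamp], that is [- A q]. *)
Lemma code_cdf_low_diff q : 0 <= q <= 1 ->
  `|code_cdf J q - code_cdf K q| <= `|A q| + \int[J]_x gap (x, q).
Proof.
move=> q01; have FK : code_cdf K q = \int[J]_x (h x.1 * (h x.1 < q)%R%:R).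
  rewrite code_cdfE Rint_resampled//; last exact: bmeas_encode_lt.
  apply: eq_Rintegral => x _.
  by rewrite !encode_lt_low// /label/= clamp_id//; ring.
have FJ : code_cdf J q = \int[J]_x (label x * (clamp x.1 < q)%R%:R).
  by rewrite code_cdfE; apply: eq_Rintegral => x _; rewrite encode_lt_low.
have b1 : bmeas (fun x : T => clamp x.1 * (clamp x.1 < q)%R%:R) by exact: bmeasM.
have b2 : bmeas (fun x : T => h x.1 * (h x.1 < q)%R%:R) by exact: bmeasM.
have b3 := bmeasM blab (bltc q).
have -> : code_cdf J q - code_cdf K q = \int[J]_x
    (clamp x.1 * (clamp x.1 < q)%R%:R - h x.1 * (h x.1 < q)%R%:R) - A q.
  rewrite FJ FK /A -!RintB//.
  - by apply: eq_Rintegral => x _; rewrite /lower_bin /residual/=; ring.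
  - exact: bmeasB.
  - exact: (bmeas_pair2 (@bmeas_lower_bin R) q).
rewrite addrC (le_trans (ler_normD _ _))// normrN lerD2l.
apply: (le_trans (ler_norm_Rint _ (bmeasB b1 b2))).
apply: le_Rint => //; first exact: (bmeas_norm (bmeasB b1 b2)).
by move=> x; apply: binned_diff_le => //; rewrite clamp_ge0 clamp_le1.
Qed.

(** The points with label 1 contribute the common label mean to both sides and cancel. For label 0
    the argument is the same with complements to 1, which turns [- A q] into [A q]. *)
Lemma code_cdf_high_diff q : 0 <= q <= 1 ->
  `|code_cdf J (q + 2) - code_cdf K (q + 2)| <= `|A q| + \int[J]_x gap (x, q).
Proof.
move=> q01.
have b1h := bmeasB (bc 1) bh; have b1c := bmeasB (bc 1) bcl.
have b1l := bmeasB (bc 1) blab.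
have b1 := bmeasM b1c (bltc q); have b2 := bmeasM b1h (blth q).
have b3 := bmeasM b1l (bltc q).
have FK : code_cdf K (q + 2) =
    \int[J]_x label x + \int[J]_x ((1 - h x.1) * (h x.1 < q)%R%:R).
  rewrite code_cdfE Rint_resampled//; last exact: bmeas_encode_lt.
  rewrite -hE -RintD//; apply: eq_Rintegral => x _.
  by rewrite !encode_lt_high// /label/= clamp_id//; ring.
have FJ : code_cdf J (q + 2) =
    \int[J]_x label x + \int[J]_x ((1 - label x) * (clamp x.1 < q)%R%:R).
  rewrite code_cdfE -RintD//.
  by apply: eq_Rintegral => x _; rewrite encode_lt_high.
have bl := bmeas_pair2 (@bmeas_lower_bin R) q.
have -> : code_cdf J (q + 2) - code_cdf K (q + 2) = A q + \int[J]_x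
    ((1 - clamp x.1) * (clamp x.1 < q)%R%:R - (1 - h x.1) * (h x.1 < q)%R%:R).
  rewrite FJ FK opprD addrACA subrr add0r /A -RintB// -RintD//; last exact: bmeasB.
  by apply: eq_Rintegral => x _; rewrite /lower_bin /residual/=; ring.
rewrite (le_trans (ler_normD _ _))// lerD2l.
apply: (le_trans (ler_norm_Rint _ (bmeasB b1 b2))).
apply: le_Rint => //; first exact: (bmeas_norm (bmeasB b1 b2)).
move=> x; rewrite /gap/= (_ : clamp x.1 - h x.1 = - ((1 - clamp x.1) - (1 - h x.1)));
  last by ring.
rewrite normrN; apply: binned_diff_le.
  by have := clamp_ge0 x.1; have := clamp_le1 x.1; lra.
by have := h01 x.1; lra.
Qed.

(** Averaged over [q], the indicator part of [gap] is again [|clamp v - h v|], hence the factor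
    2. *)
Lemma gap_mean : \int[U]_q \int[J]_x gap (x, q) =
  2 * \int[J]_x `|clamp x.1 - h x.1|.
Proof.
have bd := bmeas_norm (bmeasB bcl bh).
rewrite -(Rint_exchange J U bgap) -RintZ//; apply: eq_Rintegral => x _.
rewrite /gap/= RintD; [|exact: bmeas_cst|].
  by rewrite Rint_cst Rint_unif01_dist_gt ?h01 ?clamp_ge0 ?clamp_le1//; ring.
exact: (bmeas_norm (bmeasB (bmeas_gt _) (bmeas_gt _))).
Qed.

(** The two differences of distribution functions each cost [|A q|] plus the mean of [gap], and
    [gap] averages to twice the displacement: this gives the constants 2 and 4. *)
Lemma lower_distCal_le_bins : on_unit J -> lower_distCal J <=
  2 * \int[U]_q `|A q| + 4 * \int[J]_x `|clamp x.1 - h x.1|.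
Proof.
move=> J1.
have K1 := resampled_on_unit J mh h01; have cK := resampled_calibrated J mh h01.
apply: (le_trans (lower_distCal_le_cdf J1 K1 cK label_resampled)).
have bA : bmeas (fun q => `|A q|) := bmeas_norm (bmeas_Rint2 J (@bmeas_lower_bin R)).
have bG := bmeas_Rint2 J bgap.
apply: (@le_trans _ _ (\int[U]_q (2 * `|A q| + 2 * \int[J]_x gap (x, q)))).
  have m01 : measurable (`[0, 1[%classic : set R) by exact: measurable_itv.
  have bF (L : probability T R) : bmeas (fun q => code_cdf L q).
    split; first exact: measurable_code_cdf.
    by exists 1 => q; rewrite ler_norml; have := code_cdf_itv L q; lra.
  have bF2 (L : probability T R) : bmeas (fun q : R => code_cdf L (q + 2)).
    apply: (bmeas_comp _ (bF L)).
    by apply: measurable_funD => //; exact: measurable_cst.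
  apply: (le_Rint_on m01 (unif01_itv01 R)).
  - exact: (bmeasD (bmeas_norm (bmeasB (bF J) (bF K)))
                   (bmeas_norm (bmeasB (bF2 J) (bF2 K)))).
  - exact: (bmeasD (bmeasM (bmeas_cst _ _) bA) (bmeasM (bmeas_cst _ _) bG)).
  move=> q /=; rewrite in_itv/= => /andP[q0 /ltW q1].
  have q01 : 0 <= q <= 1 by rewrite q0 q1.
  by apply: (le_trans (lerD (code_cdf_low_diff q01) (code_cdf_high_diff q01))); lra.
rewrite RintD; [|by apply: bmeasM => //; exact: bmeas_cst
  |by apply: bmeasM => //; exact: bmeas_cst].
by rewrite !RintZ// gap_mean; lra.
Qed.

End distCal_ATB.

Lemma lower_distCal_ge0 (R : realType) (J : probability (R * bool)%type R) :
  0 <= lower_distCal J.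
Proof.
rewrite /lower_distCal; set S := [set _ | _ in _].
have [->|S0] := eqVneq S set0; first by rewrite inf0.
apply: lb_le_inf; first by apply/set0P.
by move=> _ [Q _ <-]; apply: Rintegral_ge0.
Qed.

Lemma calibration_measure_lower_distCal (R : realType) :
  calibration_measure (@lower_distCal R).
Proof.
split=> [J J' _ _ JJ'|J _]; last exact: lower_distCal_ge0.
rewrite /lower_distCal; congr inf; apply/seteqP.
by split => _ [Q [Q1 Q2 Q3] <-]; exists Q => //; split => // A mA;
  rewrite Q1// JJ'.
Qed.

Lemma lower_distCal_sqr_le (R : realType) (J : probability (R * bool)%type R) :
  on_unit J -> lower_distCal J ^+ 2 <= 72 * ATB J.
Proof.
move=> J1; have [h [mh h01 hE hD]] := exists_mean_shift J.
have := lower_distCal_le_bins mh h01 hE J1; rewrite hD => dle.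
have d0 := lower_distCal_ge0 J.
have bl := @bmeas_lower_bin R; have bu := @bmeas_upper_bin R.
have bA := bmeas_Rint2 J bl; have bB := bmeas_Rint2 J bu.
set A := fun q => \int[J]_x lower_bin (x, q).
set B := fun q => \int[J]_x upper_bin (x, q).
have ATB_E : ATB J = \int[unif01 R]_q (A q ^+ 2 + B q ^+ 2) by rewrite ATBE.
(* The two bins at any threshold add up to the whole mean residual, so its square is at most
   [2 (A q ^ 2 + B q ^ 2)] for every [q]. *)
have dq q : \int[J]_x residual x = A q + B q.
  rewrite /A /B -RintD; [|exact: bmeas_pair2|exact: bmeas_pair2].
  apply: eq_Rintegral => x _; rewrite /lower_bin /upper_bin/= leNgt.
  by case: (_ < _); rewrite /= ?mulr1 ?mulr0 ?addr0 ?add0r.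
have bE : bmeas (fun q => A q ^+ 2 + B q ^+ 2) := bmeasD (bmeasX2 bA) (bmeasX2 bB).
have d2 : (\int[J]_x residual x) ^+ 2 <= 2 * ATB J.
  rewrite ATB_E -RintZ// -[leLHS](Rint_cst (unif01 R)).
  apply: le_Rint; [exact: bmeas_cst|exact: (bmeasM (bmeas_cst _ _) bE)|].
  move=> q; rewrite (dq q); move: (A q) (B q) => a b.
  by have := sqr_ge0 (a - b); nra.
have a2 : (\int[unif01 R]_q `|A q|) ^+ 2 <= ATB J.
  apply: (le_trans (sqr_Rint_le _ (bmeas_norm bA))); rewrite ATB_E.
  apply: le_Rint => //; first exact: (bmeasX2 (bmeas_norm bA)).
  by move=> q; rewrite real_normK ?num_real// lerDl sqr_ge0.
have a0 : 0 <= \int[unif01 R]_q `|A q| by apply: Rintegral_ge0.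
move: dle d2 a2 a0 d0; rewrite -/A -[X in X <= 2 * _]real_normK ?num_real//.
have := normr_ge0 (\int[J]_x residual x).
move: (lower_distCal J) (ATB J) (\int[unif01 R]_q `|A q|) `|\int[J]_x residual x|.
move=> D t a d d0 dle d2 a2 a0 D0.
have : D ^+ 2 <= (2 * a + 4 * d) ^+ 2 by rewrite ler_pXn2r ?nnegrE// addr_ge0// mulr_ge0.
(* [(2 a + 4 d)^2 <= 8 a^2 + 32 d^2 <= (8 + 64) t], which is the constant 72. *)
have := sqr_ge0 (2 * a - 4 * d); nra.
Qed.

(** * Two-point lower bound *)

Section mean_bias.
Variables (R : realType) (J : probability (R * bool)%type R).
Variable Q : probability (R * (R * bool))%type R.
Hypotheses (J1 : on_unit J) (QJ : calibrated_coupling J Q).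

Let Rint_snd (f : R * bool -> R) : bmeas f -> \int[Q]_x f x.2 = \int[J]_x f x.
Proof.
move=> bf; have [QJ1 _ _] := QJ.
pose S : {mfun (R * (R * bool))%type >-> (R * bool)%type} := HB.pack
  (snd : R * (R * bool) -> R * bool)
  (isMeasurableFun.Build _ _ _ _ (snd : R * (R * bool) -> R * bool) measurable_snd).
rewrite -(@eq_measure_Rint _ _ _ (distribution Q S) J)//.
by rewrite Rint_distribution//; [exact: bf.1|exact: bmeas_comp bf].
Qed.

Let Rint_proj (f : R * bool -> R) : bmeas f ->
  \int[distribution Q (@proj_uy R)]_x f x = \int[Q]_x f (x.1, x.2.2).
Proof.
move=> bf; rewrite Rint_distribution//; first exact: bf.1.
exact: (bmeas_comp (@measurable_proj_uy R) bf).
Qed.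

Lemma mean_bias_le_cost :
  `|\int[J]_x residual x| <= \int[Q]_x `|x.1 - x.2.1|.
Proof.
have [QJ1 u1 cu] := QJ; have mU := @measurable_unit_domain R.
have m1 : measurable_fun setT (fun x : R * (R * bool) => x.1).
  exact: measurable_fst.
have m21 : measurable_fun setT (fun x : R * (R * bool) => x.2.1).
  exact: (measurableT_comp measurable_fst measurable_snd).
have b1 : bmeas (fun x : R * (R * bool) => clamp x.1).
  exact: (bmeas_comp (@measurable_proj_uy R) (@bmeas_clamp1 R)).
have b2 : bmeas (fun x : R * (R * bool) => clamp x.2.1).
  exact: (bmeas_comp measurable_snd (@bmeas_clamp1 R)).
have bl : bmeas (fun x : R * (R * bool) => label x.2).
  exact: (bmeas_comp measurable_snd (@bmeas_label R)).
have -> : \int[Q]_x `|x.1 - x.2.1| = \int[Q]_x `|clamp x.1 - clamp x.2.1|.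
  (* The two clamps are inserted one at a time: [u] is in [[0, 1]] almost surely by the projected
     law, [v] by the law [J]. *)
  transitivity (\int[Q]_x `|clamp x.1 - x.2.1|).
    apply: (@Rint_ae_eq _ _ _ _ _ _ (@proj_uy R @^-1` @unit_domain R)) => //.
    - by rewrite -[X in measurable X]setTI; exact: measurable_proj_uy.
    - by apply: measurableT_comp => //; exact: measurable_funB.
    - by apply: measurableT_comp => //; apply: measurable_funB => //; exact: b1.1.
    - by move=> x /clamp_unit /= ->.
  apply: (@Rint_ae_eq _ _ _ _ _ _ (snd @^-1` @unit_domain R)) => //.
  - by rewrite -[X in measurable X]setTI; exact: measurable_snd.
  - by rewrite QJ1.
  - by apply: measurableT_comp => //; apply: measurable_funB => //; exact: b1.1.
  - exact: (bmeas_norm (bmeasB b1 b2)).1.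
  - by move=> x /clamp_unit /= ->.
have -> : \int[J]_x residual x = - \int[Q]_x (clamp x.1 - clamp x.2.1).
  (* With the whole line as test set, calibration says that [u] and [y] have the same mean. *)
  have := calibrated_moments u1 cu measurableT.
  rewrite Rint_proj/=; last first.
    by apply: bmeasM; [exact: bmeas_residual|exact: (bmeas_indic_fst measurableT)].
  under eq_Rintegral do rewrite indicT mulr1.
  rewrite /residual/= RintB// => /eqP; rewrite subr_eq0 => /eqP uE.
  rewrite (RintB _ b1 b2) uE opprB.
  rewrite (Rint_snd (@bmeas_label R)) (Rint_snd (@bmeas_clamp1 R)) -RintB//.
    exact: bmeas_clamp1.
  exact: bmeas_label.
rewrite normrN; apply: ler_norm_Rint; exact: bmeasB.
Qed.

End mean_bias.

(** By induction [(1 + x)^n (1 - n x) <= 1]; with [y = n x <= 1/2] one concludes from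
    [(1 + 2 y) (1 - y) >= 1]. *)
Lemma expr1D_le (R : realFieldType) (x : R) n : 0 <= x -> n%:R * x <= 2^-1 ->
  (1 + x) ^+ n <= 1 + 2 * (n%:R * x).
Proof.
move=> x0; have G0 m : 0 <= (1 + x) ^+ m by rewrite exprn_ge0// addr_ge0.
have : (1 + x) ^+ n * (1 - n%:R * x) <= 1.
  elim: n => [|n IH]; first by rewrite expr0 mul0r subr0 mulr1.
  apply: le_trans IH; rewrite exprSr -mulrA ler_wpM2l//.
  have : 0 <= n.+1%:R * x ^+ 2 by rewrite mulr_ge0// sqr_ge0.
  by rewrite -natr1; nra.
have : 0 <= n%:R * x by rewrite mulr_ge0.
have := G0 n; move: ((1 + x) ^+ n) (n%:R * x) => G y; nra.
Qed.

(* The hypothesis is sharpest at [c = a - (b - a) / g]. *)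
Lemma chi_square_bound (R : realFieldType) (a b g : R) : 0 < g ->
  (forall c, (b - c) ^+ 2 <= (1 + g) * (a * (1 - 2 * c) + c ^+ 2)) ->
  (a - b) ^+ 2 <= g / 4.
Proof.
move=> g0 /(_ (a - (b - a) / g)).
set t := (b - a) / g; have ba : b = a + g * t by rewrite /t mulrC divfK ?gt_eqF ?subrKC.
rewrite ba => h; clearbody t.
have : (g * t) ^+ 2 <= g / 4; last by rewrite opprD addNKr sqrrN.
have a4 : a * (1 - a) <= 4^-1 by have := sqr_ge0 (a - 2^-1); lra.
have h2 : (1 + g) * ((1 + g) * t ^+ 2) <= (1 + g) * (t ^+ 2 + a * (1 - a)).
  by apply: le_trans (_ : _ <= (a + g * t - (a - t)) ^+ 2) _; [lra|lra].
have h3 : (1 + g) * t ^+ 2 <= t ^+ 2 + a * (1 - a).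
  by move: h2; rewrite ler_pM2l// ltr_wpDl.
have h4 : g * t ^+ 2 <= 4^-1 by lra.
by rewrite exprMn expr2 -mulrA ler_pM2l.
Qed.

(** * Change of measure between two-point laws *)

Section two_point.
Context d (X : measurableType d) (R : realType).
Variables (P0 P1 : probability X R) (x1 x2 : X) (e : R).
Hypothesis P0E : forall f : X -> R, bmeas f ->
  \int[P0]_x f x = 2^-1 * f x1 + 2^-1 * f x2.
Hypothesis P1E : forall f : X -> R, bmeas f ->
  \int[P1]_x f x = (2^-1 + e) * f x1 + (2^-1 - e) * f x2.

(* Cauchy-Schwarz for the likelihood ratio of [P1^n] to [P0^n], whose second
   moment under [P0^n] is [(1 + 4 e^2)^n]. *)
Lemma iid_two_point_change n (f : n.-tuple X -> R) : bmeas f ->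
  (\int[iid P1 n]_s f s) ^+ 2 <=
  (1 + 4 * e ^+ 2) ^+ n * \int[iid P0 n]_s (f s ^+ 2).
Proof.
elim: n f => [|n IH] f bf; first by rewrite expr0 mul1r; exact: sqr_Rint_le.
have bf2 := bmeas_comp (@Defs.measurable_cons_tuple _ X n) bf.
have bf3 := bmeas_comp (@Defs.measurable_cons_tuple _ X n) (bmeasX2 bf).
rewrite (Rint_iidS _ bf) (Rint_iidS _ (bmeasX2 bf)).
rewrite (P1E (bmeas_Rint1 (iid P1 n) bf2)) (P0E (bmeas_Rint1 (iid P0 n) bf3)).
have := IH _ (bmeas_pair1 bf2 x1); have := IH _ (bmeas_pair1 bf2 x2).
have : 0 <= (1 + 4 * e ^+ 2) ^+ n.
  by rewrite exprn_ge0// addr_ge0// mulr_ge0// sqr_ge0.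
have : 0 <= 4 * e ^+ 2 by rewrite mulr_ge0// sqr_ge0.
rewrite (exprS (1 + 4 * e ^+ 2)).
move: ((1 + 4 * e ^+ 2) ^+ n) => G.
move: (\int[iid P1 n]_s f (Defs.cons_tuple (x1, s))) => Y1.
move: (\int[iid P1 n]_s f (Defs.cons_tuple (x2, s))) => Y2.
move: (\int[iid P0 n]_s (f (Defs.cons_tuple (x1, s)) ^+ 2)) => Z1.
move: (\int[iid P0 n]_s (f (Defs.cons_tuple (x2, s)) ^+ 2)) => Z2.
clear; move=> e2 G0 H2 H1.
(* Cauchy-Schwarz for the first draw, with [(1/2 + e)^2 + (1/2 - e)^2 = (1 + 4 e^2) / 2]; the defect
   is the square supplied next. *)
apply: (@le_trans _ _ ((1 + 4 * e ^+ 2) * (2^-1 * Y1 ^+ 2 + 2^-1 * Y2 ^+ 2))).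
  by have := sqr_ge0 ((2^-1 + e) * Y2 - (2^-1 - e) * Y1); lra.
rewrite -mulrA ler_wpM2l ?addr_ge0//; lra.
Qed.

(** The divergence [G - 1] is at most [8 n e^2] by [expr1D_le], whose condition [4 n e^2 <= 1/2] is
    the bound [8^-1]; [chi_square_bound] divides by 4. *)
Lemma iid_two_point_close n (E : set (n.-tuple X)) :
  e != 0 -> (0 < n)%N -> n%:R * e ^+ 2 <= 8^-1 -> measurable E ->
  (fine (iid P0 n E) - fine (iid P1 n E)) ^+ 2 <= 2 * (n%:R * e ^+ 2).
Proof.
move=> e0 n0 ne mE; have e20 : 0 < e ^+ 2 by rewrite exprn_even_gt0.
set G := (1 + 4 * e ^+ 2) ^+ n.
have G1 : 1 < G by rewrite exprn_egt1 ?gtn_eqF// ltrDl mulr_gt0.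
have GE : G <= 1 + 2 * (n%:R * (4 * e ^+ 2)).
  by apply: expr1D_le; [rewrite mulr_ge0// ltW|rewrite mulrCA; lra].
have bE := bmeas_indic R mE.
(* The change of measure is applied to the indicator of [E] minus a free constant [c]; since an
   indicator is its own square, the second moment is affine in the probability of [E]. *)
have key c : (fine (iid P1 n E) - c) ^+ 2 <=
    (1 + (G - 1)) * (fine (iid P0 n E) * (1 - 2 * c) + c ^+ 2).
  have bc := bmeas_cst (n.-tuple X) c.
  have := iid_two_point_change (bmeasB bE bc).
  rewrite (RintB _ bE bc) Rint_cst Rint_indic// subrKC => /le_trans; apply.
  rewrite le_eqVlt; apply/orP; left; apply/eqP; congr (_ * _).
  transitivity (\int[iid P0 n]_s ((1 - 2 * c) * \1_E s + c ^+ 2)).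
    apply: eq_Rintegral => s _; rewrite indicE.
    by case: (_ \in _) => /=; ring.
  rewrite RintD; [|by apply: bmeasM => //; exact: bmeas_cst|exact: bmeas_cst].
  by rewrite Rint_cst RintZ// Rint_indic// mulrC.
have g0 : 0 < G - 1 by rewrite subr_gt0.
apply: (le_trans (chi_square_bound g0 key)).
by move: GE; rewrite mulrCA; lra.
Qed.

End two_point.

(** * Biased coins with constant prediction one half *)

Section coin.
Variable R : realType.
Local Notation U := (unif01 R).

Definition toss (p s : R) : R * bool := (2^-1, s < p).

Lemma measurable_toss p : measurable_fun setT (toss p).
Proof.
apply: measurable_fun_pair; first exact: measurable_cst.
by apply: measurable_fun_ltr => //; exact: measurable_cst.
Qed.

HB.instance Definition _ p := isMeasurableFun.Build _ _ _ _
  (toss p) (@measurable_toss p).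

Definition coin (p : R) : probability (R * bool)%type R := distribution U (toss p).

Lemma Rint_coin p (f : R * bool -> R) : 0 <= p <= 1 -> bmeas f ->
  \int[coin p]_x f x = p * f (2^-1, true) + (1 - p) * f (2^-1, false).
Proof.
move=> p01 bf; rewrite Rint_distribution//; last first.
- exact: (bmeas_comp (measurable_toss p) bf).
- exact: bf.1.
transitivity (\int[U]_s ((f (2^-1, true) - f (2^-1, false)) * (s < p)%R%:R
   + f (2^-1, false))).
  by apply: eq_Rintegral => s _; rewrite /= /toss; case: (s < p);
    rewrite ?mulr1 ?mulr0 ?add0r ?subrK.
rewrite RintD; [|by apply: bmeasM; [exact: bmeas_cst|exact: bmeas_lt]
  |exact: bmeas_cst].
rewrite Rint_cst RintZ; last exact: bmeas_lt.
by rewrite Rint_unif01_lt//; ring.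
Qed.

Lemma half_itv : 0 <= (2^-1 : R) <= 1.
Proof. by rewrite invr_ge0 ler0n invf_le1 ?ler1n. Qed.

Lemma coin_on_unit p : on_unit (coin p).
Proof.
have preT : toss p @^-1` (@unit_domain R) = setT.
  by apply/seteqP; split => // s _; apply/(unit_domainP _).2; exact: half_itv.
rewrite /on_unit /coin /distribution/= /pushforward preT.
exact: probability_setT.
Qed.

Lemma coin_half_calibrated : calibrated (coin 2^-1).
Proof.
apply: calibrated_from_moments => [|A mA]; first exact: coin_on_unit.
have bA := bmeas_indic_fst mA.
rewrite !Rint_coin ?half_itv//.
- by rewrite /label/= clamp_id ?half_itv//; field.
- by apply: bmeasM => //; exact: bmeas_clamp1.
- by apply: bmeasM => //; exact: bmeas_label.
Qed.

Lemma coin_bias p : 0 <= p <= 1 -> \int[coin p]_x residual x = 2^-1 - p.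
Proof.
move=> p01; rewrite Rint_coin//; last exact: bmeas_residual.
by rewrite /residual /label/= clamp_id ?half_itv//; ring.
Qed.

Definition pair_with (p : R) (x : R * bool) : R * (R * bool) := (p, x).

Lemma measurable_pair_with p : measurable_fun setT (pair_with p).
Proof. exact: pair1_measurable. Qed.

HB.instance Definition _ p := isMeasurableFun.Build _ _ _ _
  (pair_with p) (@measurable_pair_with p).

(** The constant prediction [p] is calibrated for labels of mean [p]. This makes the infimum in
    [lower_distCal] range over a nonempty set; over the empty set it would be 0 by convention. *)
Lemma coin_coupling p : 0 <= p <= 1 ->
  calibrated_coupling (coin p) (distribution (coin p) (pair_with p)).
Proof.
move=> p01; have preT : pair_with p @^-1` (@proj_uy R @^-1` (@unit_domain R)) = setT.
  by apply/seteqP; split => // s _; apply/(unit_domainP _).2.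
have u1 : on_unit (distribution (distribution (coin p) (pair_with p)) (@proj_uy R)).
  rewrite /on_unit; transitivity (coin p setT); last exact: probability_setT.
  by rewrite -preT.
split => //; apply: calibrated_from_moments => // A mA.
have E (f : R * bool -> R) : bmeas f ->
    \int[distribution (distribution (coin p) (pair_with p)) (@proj_uy R)]_x f x =
    p * f (p, true) + (1 - p) * f (p, false).
  move=> bf; have bf2 := bmeas_comp (@measurable_proj_uy R) bf.
  have bf3 := bmeas_comp (@measurable_pair_with p) bf2.
  rewrite Rint_distribution//; last exact: bf.1.
  rewrite Rint_distribution//; last exact: bf2.1.
  by rewrite (Rint_coin p01 bf3).
have bA := bmeas_indic_fst mA.
rewrite !E.
- by rewrite /label/= clamp_id//; ring.
- by apply: bmeasM => //; exact: bmeas_clamp1.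
- by apply: bmeasM => //; exact: bmeas_label.
Qed.

Lemma coin_lower_distCal p : 0 <= p <= 1 -> `|2^-1 - p| <= lower_distCal (coin p).
Proof.
move=> p01; rewrite -(coin_bias p01); apply: lb_le_inf.
  by eexists; exists (distribution (coin p) (pair_with p)) => //; exact: coin_coupling.
by move=> _ [Q QJ <-]; apply: mean_bias_le_cost QJ; exact: coin_on_unit.
Qed.

Lemma coin_indistinguishable (e : R) n (E : set (n.-tuple (R * bool)%type)) :
  e != 0 -> 0 <= 2^-1 + e <= 1 -> (0 < n)%N -> n%:R * e ^+ 2 <= 8^-1 ->
  measurable E ->
  (fine (iid (coin 2^-1) n E) - fine (iid (coin (2^-1 + e)) n E)) ^+ 2 <=
  2 * (n%:R * e ^+ 2).
Proof.
move=> e0 e01.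
pose x1 : R * bool := (2^-1, true); pose x2 : R * bool := (2^-1, false).
have P0E (f : R * bool -> R) : bmeas f ->
    \int[coin 2^-1]_x f x = 2^-1 * f x1 + 2^-1 * f x2.
  by move=> bf; rewrite Rint_coin ?half_itv// -/x1 -/x2; field.
have P1E (f : R * bool -> R) : bmeas f ->
    \int[coin (2^-1 + e)]_x f x = (2^-1 + e) * f x1 + (2^-1 - e) * f x2.
  by move=> bf; rewrite Rint_coin// -/x1 -/x2; field.
exact: (iid_two_point_close P0E P1E).
Qed.

End coin.

(** * Validity *)

Section limn_einf_real.
Variable R : realType.
Implicit Types u : nat -> R.

(** The lower limit is the supremum of the tail infima, so one of them is positive. Capping it at 1
    keeps the bias of the coin small later on. *)
Lemma limn_einf_gt0 u : (0 < limn_einf (EFin \o u))%E ->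
  exists2 eta : R, 0 < eta <= 1 & exists N, forall n, (N <= n)%N -> eta <= u n.
Proof.
rewrite limn_einf_lim (cvg_lim _ (@cvg_einfs_sup _ (EFin \o u)))//.
move=> /ereal_sup_gt[_ [N _ <-] N0].
have uN n : (N <= n)%N -> (einfs (EFin \o u) N <= (u n)%:E)%E.
  by move=> Nn; apply: ereal_inf_lbound; exists n.
case E : (einfs (EFin \o u) N) N0 uN => [r| |] //.
- rewrite lte_fin => r0 uN; exists (Num.min r 1).
    by rewrite lt_min r0 ltr01 ge_min lexx orbT.
  exists N => n /uN; rewrite lee_fin; apply: le_trans.
  by rewrite ge_min lexx.
(* The tail infimum cannot be infinite, since it is below the real number [u N]. *)
- by move=> _ /(_ N (leqnn N)).
Qed.

Lemma limn_einf_ge u (eta : R) :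
  (\forall n \near \oo, eta <= u n) -> (eta%:E <= limn_einf (EFin \o u))%E.
Proof.
move=> [N _ uN]; rewrite limn_einf_lim (cvg_lim _ (@cvg_einfs_sup _ (EFin \o u)))//.
apply: (@le_trans _ _ (einfs (EFin \o u) N)); last by apply: ereal_sup_ubound; exists N.
by apply: le_ereal_inf_tmp => _ [n Nn <-]; rewrite /= lee_fin uN.
Qed.

End limn_einf_real.

(** * Acceptance probabilities and the two bounds *)

Section acceptance.
Variable R : realType.
Implicit Types J : probability (R * bool)%type R.

Lemma accP_ge0 CAL J n beta : 0 <= accP CAL J n beta.
Proof. by rewrite /accP fine_ge0. Qed.

Lemma accP_le1 (CAL : probability (R * bool)%type R -> R) J n beta :
  measurable_acceptance CAL -> (0 < n)%N -> accP CAL J n beta <= 1.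
Proof.
move=> mC n0; have mE := mC n beta n0.
by rewrite /accP -lee_fin fineK ?fin_num_measure//; exact: probability_le1.
Qed.

Let measurable_dev J n (c : R) :
  measurable [set s : n.-tuple (R * bool)%type | c < ATB_deviation J s].
Proof.
have bd : bmeas (fun s : n.-tuple (R * bool)%type => ATB_deviation J s).
  by apply: bmeasD; apply: bmeas_deviation;
    [exact: bmeas_lower_bin|exact: bmeas_upper_bin].
have -> : [set s : n.-tuple (R * bool)%type | c < ATB_deviation J s] =
   setT `&` (fun s => ATB_deviation J s) @^-1` `]c, +oo[%classic.
  by apply/seteqP; split => s /=; rewrite in_itv/= andbT => //; case.
by apply: bd.1 => //; exact: measurable_itv.
Qed.

(** For calibrated [J] the statistic equals its deviation, so on samples from [unit_domain]
    rejection is exactly the tail event. *)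
Lemma accP_ATB_calibrated J n : (0 < n)%N -> on_unit J -> calibrated J ->
  3 / 4 <= accP (@ATB R) J n (8 / n%:R).
Proof.
move=> n0 J1 cJ.
set D := [set s : n.-tuple (R * bool)%type | 8 / n%:R < ATB_deviation J s].
have mD : measurable D := @measurable_dev J n _.
have tail := ATB_deviation_gt J n0.
have mU := @measurable_unit_domain R.
have accE : iid J n (@accept_event R (@ATB R) n (8 / n%:R)) = iid J n (~` D).
  have mE := measurable_acceptance_ATB (8 / n%:R : R) n0.
  have mF := @measurable_forall_tnth _ _ _ mU n.
  apply: (eq_probability_on mE (measurableC mD) mF (iid_support mU J1 n)) => s us.
  have lb q := (calibrated_bins q J1 cJ).1.
  have ub q := (calibrated_bins q J1 cJ).2.
  rewrite /accept_event/= ATB_empirical//.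
  rewrite (ATB_sample_centered s lb ub) /D/=.
  by rewrite leNgt; split=> [[_ /negP]|/negP].
rewrite /accP accE probability_setC// fineB ?fin_num_measure//=.
by move: tail; rewrite -/D; move: (fine _) => t; lra.
Qed.

(** Acceptance gives [ATB J <= 2 (8 / n) + 2 dev], so [ATB J > 32 / n] forces the deviation above
    [8 / n]. *)
Lemma accP_ATB_far J n : (0 < n)%N -> on_unit J -> 32 / n%:R < ATB J ->
  accP (@ATB R) J n (8 / n%:R) <= 4^-1.
Proof.
move=> n0 J1 far; apply: le_trans (ATB_deviation_gt J n0).
have mE := measurable_acceptance_ATB (8 / n%:R : R) n0.
have mD := @measurable_dev J n (8 / n%:R).
rewrite /accP fine_le ?fin_num_measure//.
apply: le_measure; rewrite ?inE// => s [us].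
rewrite ATB_empirical//= => sle; have := ATB_le_sample s J1.
move: far sle; rewrite -![_ / n%:R]mulrC.
move: (ATB J) (ATB_sample s) (ATB_deviation J s) (n%:R^-1 : R) => a b d m.
by lra.
Qed.

(** The constant 50 is chosen so that [50^2 = 2500] exceeds [72 * 32 = 2304]. *)
Lemma ATB_gt_of_distCal J n : (0 < n)%N -> on_unit J ->
  50 * inv_sqrt R n <= lower_distCal J -> 32 / n%:R < ATB J.
Proof.
move=> n0 J1 far; have := lower_distCal_sqr_le J1.
have nn0 : 0 < n%:R :> R by rewrite ltr0n.
have i0 : 0 <= inv_sqrt R n by rewrite invr_ge0 sqrtr_ge0.
have i2 : inv_sqrt R n ^+ 2 = n%:R^-1 by rewrite exprVn sqr_sqrtr// ltW.
have : (50 * inv_sqrt R n) ^+ 2 <= lower_distCal J ^+ 2.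
  by rewrite ler_pXn2r// ?nnegrE ?lower_distCal_ge0// mulr_ge0.
rewrite exprMn i2; have : 0 < n%:R^-1 :> R by rewrite invr_gt0.
move: (lower_distCal J ^+ 2) (ATB J) (n%:R^-1 : R) => D a m; lra.
Qed.

Lemma ATB_valid : valid (@ATB R) lower_distCal (fun n => 50 * inv_sqrt R n).
Proof.
exists (fun n => 8 / n%:R); apply: (@lt_le_trans _ _ (2^-1)%:E).
  by rewrite lte_fin invr_gt0.
apply: limn_einf_ge; exists 1%N => // n /= n0.
rewrite (_ : 2^-1 = 3 / 4 - 4^-1 :> R); last by field.
apply: lerB.
- apply: lb_le_inf.
    exists (accP (@ATB R) (coin 2^-1) n (8 / n%:R)); exists (coin 2^-1) => //.
    by split; [exact: coin_on_unit|exact: coin_half_calibrated].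
  by move=> _ [J [J1 cJ] <-]; exact: accP_ATB_calibrated.
(* There may be no [J] this far from calibration, in which case the supremum is 0. *)
- set S := [set _ | _ in _]; have [->|S0] := eqVneq S set0.
    by rewrite sup0 invr_ge0.
  apply: ge_sup; first exact/set0P.
  move=> _ [J [J1 far] <-]; apply: accP_ATB_far => //.
  exact: ATB_gt_of_distCal.
Qed.

(** If [gamma n] were below [e = (eta / 4) / sqrt n], the coin of bias [e] would count among the far
    laws, and its acceptance probability would differ from that of the fair coin by at least [eta].
    But the square of this difference is at most [2 n e^2 = eta^2 / 8]. *)
Lemma valid_lower_bound (CAL : probability (R * bool)%type R -> R) gamma :
  measurable_acceptance CAL -> valid CAL lower_distCal gamma ->
  exists2 c : R, 0 < c & \forall T \near \oo, c * inv_sqrt R T <= gamma T.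
Proof.
move=> mC [beta /limn_einf_gt0[eta /andP[eta0 eta1] [N etaN]]].
exists (eta / 4); first by rewrite divr_gt0.
exists (maxn N 1) => // n /=; rewrite geq_max => /andP[Nn n0].
rewrite leNgt; apply/negP => gn.
set e := eta / 4 * inv_sqrt R n in gn.
have nn0 : 0 < n%:R :> R by rewrite ltr0n.
have i0 : 0 < inv_sqrt R n by rewrite invr_gt0 sqrtr_gt0.
have i1 : inv_sqrt R n <= 1.
  by rewrite invf_le1 ?sqrtr_gt0// -[leLHS]sqrtr1 ler_sqrt// ler1n.
have i2 : n%:R * inv_sqrt R n ^+ 2 = 1.
  by rewrite exprVn sqr_sqrtr ?ltW// mulfV// gt_eqF.
have e0 : 0 < e by rewrite mulr_gt0// divr_gt0.
have e4 : e <= 4^-1.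
  by apply: (@le_trans _ _ (eta / 4 * 1)); [rewrite ler_pM2l ?divr_gt0|lra].
have ne : n%:R * e ^+ 2 = eta ^+ 2 / 16.
  by rewrite exprMn mulrCA i2 mulr1; field.
have eta2 : eta ^+ 2 <= 1 by rewrite expr_le1// ltW.
have p01 : 0 <= 2^-1 + e <= 1 by lra.
have ne8 : n%:R * e ^+ 2 <= 8^-1 by rewrite ne; lra.
have mE := mC n (beta n) n0.
have := coin_indistinguishable (lt0r_neq0 e0) p01 n0 ne8 mE.
have := etaN n Nn; rewrite ne.
set a := fine _; set b := fine _ => etaI.
suff : eta <= a - b.
  move=> ab; have : eta ^+ 2 <= (a - b) ^+ 2.
    by rewrite ler_pXn2r// nnegrE ?ltW// (lt_le_trans eta0).
  have : 0 < eta ^+ 2 by rewrite exprn_gt0.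
  by move: (eta ^+ 2) ((a - b) ^+ 2) => x y; lra.
apply: (le_trans etaI); apply: lerB.
- apply: ge_inf; first by exists 0 => _ [J _ <-]; exact: accP_ge0.
  exists (coin 2^-1) => //.
  by split; [exact: coin_on_unit|exact: coin_half_calibrated].
- apply: ub_le_sup; first by exists 1 => _ [J _ <-]; exact: accP_le1.
  exists (coin (2^-1 + e)) => //; split; first exact: coin_on_unit.
  apply: le_trans (coin_lower_distCal p01).
  by rewrite opprD addNKr normrN ger0_norm ltW.
Qed.

End acceptance.

Theorem theorem5p1 (R : realType) :
  [/\ calibration_measure (@ATB R),
      measurable_acceptance (@ATB R),
      calibration_measure (@lower_distCal R) &
      exists gamma : nat -> R,
        gamma =O_\oo (@inv_sqrt R) /\ valid ATB lower_distCal gamma] /\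
  (forall gamma : nat -> R,
     (exists CAL : probability (R * bool)%type R -> R,
        [/\ calibration_measure CAL, measurable_acceptance CAL &
            valid CAL lower_distCal gamma]) ->
     exists2 c : R, 0 < c & \forall T \near \oo, c * inv_sqrt R T <= gamma T).

Proof.
split; last first.
  move=> gamma [CAL [_ mC vC]]; exact: valid_lower_bound mC vC.
split.
- exact: calibration_measure_ATB.
- exact: measurable_acceptance_ATB.
- exact: calibration_measure_lower_distCal.
exists (fun n => 50 * inv_sqrt R n); split; last exact: ATB_valid.
apply/eqOP; near=> k; apply: nearW => n.
rewrite normrM ler_wpM2r// ger0_norm//.
Unshelve. all: by end_near. Qed.
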